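(* Let $1<\alpha\le 2$ and let $Z_\alpha=(Z_\alpha(t))_{t\ge 0}$ be an $\alpha$-stable Lévy process with skewness parameter $\beta=-1$ and shift parameter $\mu=0$. Then for every $t>0$ and every $u\ge 0$, $$\mathbb{P}\Big(\sup_{s\le t}Z_\alpha(s)\ge u\Big)=\alpha\,\mathbb{P}\big(Z_\alpha(t)\ge u\big).$$
   Context: A Lévy process starts at $0$, has independent and stationary increments and càdlàg paths. The supremum is over $s\in[0,t]$. Using the standard (Samorodnitsky–Taqqu) parametrization, an $\alpha$-stable Lévy process with $1<\alpha\le 2$, skewness parameter $\beta=-1$, shift parameter $\mu=0$ and scale $\sigma>0$ is the Lévy process with $$\mathbb{E}\,e^{i\theta Z_\alpha(t)}=\exp\Big(-t\,\sigma^\alpha|\theta|^\alpha\big(1+i\,\mathrm{sign}(\theta)\tan(\pi\alpha/2)\big)\Big),\qquad \theta\in\mathbb{R},\ t\ge 0 .$$ For $1<\alpha<2$ this process is spectrally negative (has no positive jumps); for $\alpha=2$ it is a (scaled) Wiener process. *)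

(* Defs.v *)
From HB Require Import structures.
From mathcomp Require Import all_boot all_order all_algebra.
From mathcomp Require Import all_classical all_reals all_analysis measurable_realfun.
From mathcomp Require Import complex.

Set Implicit Arguments.
Unset Strict Implicit.
Unset Printing Implicit Defensive.

Import Order.TTheory GRing.Theory Num.Theory.
Import numFieldNormedType.Exports.

Local Open Scope classical_set_scope.
Local Open Scope ring_scope.
Local Open Scope complex_scope.

(* Mutual independence of a finite family. Subfamilies need no separate clause:
   take B i = setT for the discarded indices. *)
Definition mutually_independent (d : measure_display) (T : measurableType d)
    (R : realType) (P : probability T R) (I : finType)
    (X : I -> {RV P >-> R}) : Prop :=
  forall B : I -> set R, (forall i, measurable (B i)) ->
    P [set w | forall i, B i (X i w)] = (\prod_(i : I) P (X i @^-1` B i))%E.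

Definition same_distribution (d : measure_display) (T : measurableType d)
    (R : realType) (P : probability T R) (X Y : {RV P >-> R}) : Prop :=
  forall B : set R, measurable B -> distribution P X B = distribution P Y B.

Definition increment (d : measure_display) (T : measurableType d)
    (R : realType) (P : probability T R) (Z : R -> {RV P >-> R}) (s t : R) :
    {RV P >-> R} :=
  (Z t : {mfun T >-> R}) - Z s.

(* Right-continuous with (finite) left limits on [0, +oo[; nothing is required
   at negative times. *)
Definition cadlag (R : realType) (f : R -> R) : Prop :=
  (forall t, 0 <= t -> f s @[s --> t^'+] --> f t) /\
  (forall t, 0 < t -> cvg (f s @[s --> t^'-])).

(* Processes are indexed by R, but only the times t >= 0 are constrained.
   The paths are cadlag surely, so that the supremum over a compact time
   interval is a random variable on any (possibly incomplete) probability
   space; the starting value is only prescribed almost surely. *)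
Record levy_process (d : measure_display) (T : measurableType d)
    (R : realType) (P : probability T R) (Z : R -> {RV P >-> R}) : Prop := {
  levy_start0 : {ae P, forall w, Z 0 w = 0} ;
  levy_independent_increments : forall (n : nat) (t : nat -> R),
    0 <= t 0%N -> (forall i, (i < n)%N -> t i <= t i.+1) ->
    mutually_independent
      (fun i : 'I_n => increment Z (t i) (t i.+1)) ;
  levy_stationary_increments : forall s h : R, 0 <= s -> 0 <= h ->
    same_distribution (increment Z s (s + h)) (increment Z 0 h) ;
  levy_cadlag : forall w, cadlag (fun s => Z s w)
}.

Definition cexp (R : realType) (z : R[i]) : R[i] :=
  (expR (complex.Re z))%:C *
  (cos (complex.Im z) +i* sin (complex.Im z)).

(* E (exp (i theta X)), the integral of a complex function being taken on the
   real and imaginary parts; both integrands are bounded and measurable, so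
   fine discards nothing. *)
Definition char_fun (d : measure_display) (T : measurableType d)
    (R : realType) (P : probability T R) (X : {RV P >-> R}) (theta : R) : R[i] :=
  fine 'E_P[fun w => complex.Re (cexp ((theta * X w)%:C * 'i%C))] +i*
  fine 'E_P[fun w => complex.Im (cexp ((theta * X w)%:C * 'i%C))].

(* The alpha-stable Levy process (alpha != 1) with scale sigma, skewness -1 and
   shift 0, in the Samorodnitsky-Taqqu parametrization
   E exp(i theta Z_t) =
     exp(- t sigma^alpha |theta|^alpha (1 - i beta sign(theta) tan(pi alpha/2))
         + i t mu theta). *)
Definition stable_levy_process (d : measure_display) (T : measurableType d)
    (R : realType) (P : probability T R) (alpha sigma : R)
    (Z : R -> {RV P >-> R}) : Prop :=
  levy_process Z /\
  forall t theta : R, 0 <= t ->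
    char_fun (Z t) theta =
    cexp (- ((t * sigma `^ alpha * `|theta| `^ alpha)%:C *
             (1 + 'i%C * (Num.sg theta * tan (pi * alpha / 2))%:C))).

(* The supremum is taken in \bar R, so no junk value arises. *)
Definition running_sup (d : measure_display) (T : measurableType d)
    (R : realType) (P : probability T R) (Z : R -> {RV P >-> R}) (t : R)
    (w : T) : \bar R :=
  ereal_sup [set (Z s w)%:E | s in `[0, t]].

(* Main.v *)
Require Import Defs.
From mathcomp Require Import all_boot all_order all_algebra.
From mathcomp Require Import all_classical all_reals all_analysis measurable_realfun.
From HB Require Import structures.
From mathcomp Require complex.
From mathcomp Require Import ring lra.

(** Write [S] for the running supremum at time [t].  The proof compares the two
    tails [u |-> P (S > u)] and [u |-> alpha * P (Z t > u)] on the half-line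
    [u >= 0]: the first is pointwise below the second, and both have the same
    finite integral.  Both being nonincreasing and the second one
    right-continuous, they coincide; closed events are then limits of open
    ones.

    The pointwise inequality [sup_tail_le] is a first-passage argument on the
    grid of mesh [t / n].  When the walk of grid increments first exceeds [u],
    the increment of [Z] over the remaining time is independent of the past and
    is nonnegative with probability at least [1 / alpha]; in that case
    [Z t > u].  Hence the maximum over the grid exceeds [u] with probability at
    most [alpha * P (Z t > u)] ([first_passage_le]), and right-continuity of the
    paths lets the mesh go to [0].

    For the integrals, the one of [alpha * P (Z t > u)] is [alpha * E (Z t)^+],
    and the one of [P (S > u)] is at least the expectation of the grid maximum.
    By Spitzer's identity ([spitzer]) the latter is the sum over [k <= n] of
    [E (Z (k t / n))^+ / k].  The law of [Z s] gives
    [E (Z s)^+ = C * s `^ (1 / alpha)], so this sum equals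
    [C * (t / n) `^ (1 / alpha)] times the sum of the [k `^ (1 / alpha - 1)],
    which tends to [alpha * C * t `^ (1 / alpha) = alpha * E (Z t)^+].

    Three facts about the marginal laws enter, each read off from the
    characteristic function by integrating it against an explicit kernel in
    [theta] and exchanging the integrals:
    - against [theta `^ (-2)]: since the integral of
      [(1 - cos (theta x)) * theta `^ (-2)] is proportional to [|x|], the
      absolute moment [E |Z s|] is finite and scales like [s `^ (1 / alpha)]
      ([stable_abs_moment]); together with [E (Z s) = 0] ([stable_mean0]) this
      gives [E (Z s)^+];
    - against [expR (- c theta) / theta] with [c] tending to [0]: since the
      integral of [expR (- c theta) * sin (theta x) / theta] is
      [atan (x / c)], which tends to [pi / 2 * sgn x], one obtains
      [P (Z s > 0) - P (Z s < 0) = 2 / alpha - 1] ([stable_sgn_moment]);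
    - against [expR (- theta)]: the variable [Z s] has no atom at [0]
      ([stable_no_atom0]), so that [P (Z s > 0) = 1 / alpha]
      ([stable_positivity]). *)

Import Order.TTheory GRing.Theory Num.Theory.
Import numFieldNormedType.Exports.

Set Implicit Arguments.
Unset Strict Implicit.
Unset Printing Implicit Defensive.

Local Open Scope classical_set_scope.
Local Open Scope ring_scope.

(** * Elementary bounds on sine, cosine and the exponential *)

Section elementary.
Context {R : realType}.
Implicit Types x y a b c : R.

Lemma ge0_sin_le x : 0 <= x -> sin x <= x.
Proof.
rewrite le_eqVlt => /predU1P[<-|x0]; first by rewrite sin0.
have [|c _] := @MVT R sin cos 0 x x0.
  exact/continuous_subspaceT/continuous_sin.
rewrite sin0 !subr0 => ->.
by rewrite ler_piMl ?cos_le1// ltW.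
Qed.

Lemma norm_sin_le x : `|sin x| <= `|x|.
Proof.
wlog x0 : x / 0 <= x => [hw|].
  have [/hw//|x0] := leP 0 x.
  by rewrite -normrN -sinN -(normrN x) hw// oppr_ge0 ltW.
rewrite (ger0_norm x0) ler_norml ge0_sin_le// andbT.
have [x1|x1] := leP 1 x.
  by rewrite (le_trans _ (sin_geN1 x))// lerN2.
rewrite (@le_trans _ _ 0) ?oppr_le0//.
by apply: sin_ge0_pi; rewrite x0/= ltW// (lt_le_trans x1)// (le_trans _ (pi_ge2 _))// ler1n.
Qed.

Lemma one_sub_cosE x : 1 - cos x = sin (x / 2) ^+ 2 *+ 2.
Proof.
rewrite {1}(_ : x = (x / 2) *+ 2); last by rewrite -mulr_natr -mulrA mulVf ?mulr1.
by rewrite cos_mulr2n cos2sin2; ring.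
Qed.

Lemma one_sub_cos_ge0 x : 0 <= 1 - cos x.
Proof. by rewrite subr_ge0 cos_le1. Qed.

Lemma one_sub_cos_le2 x : 1 - cos x <= 2.
Proof. by have := cos_geN1 x; lra. Qed.

Lemma one_sub_cos_le_sqr x : 1 - cos x <= x ^+ 2.
Proof.
rewrite one_sub_cosE -real_normK ?num_real//.
have := norm_sin_le (x / 2).
have : 0 <= `|sin (x / 2)| by [].
rewrite -(@real_normK _ x) ?num_real// normrM normfV (@ger0_norm _ 2)//.
by have : 0 <= `|x| by []; nra.
Qed.

(** The half-angle formula makes [1 - cos] at most twice a power of a quantity
    bounded by both [1] and [|x| / 2]. *)
Lemma one_sub_cos_le_norm x : 1 - cos x <= `|x|.
Proof.
rewrite one_sub_cosE.
have := norm_sin_le (x / 2); have := sin_max (x / 2).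
rewrite -real_normK ?num_real//.
rewrite normrM normfV (@ger0_norm _ 2)//.
have : 0 <= `|sin (x / 2)| by [].
by have : 0 <= `|x| by []; nra.
Qed.

(** The mean value theorem gives [x - sin x = x * (1 - cos c)] with [c] between
    [0] and [x]; the quadratic bound is enough for [n * sin (x / n)] to tend to
    [x]. *)
Lemma sin_sub_id_le x : `|x - sin x| <= x ^+ 2.
Proof.
wlog x0 : x / 0 <= x => [hw|].
  have [/hw//|x0] := leP 0 x.
  have := hw (- x); rewrite oppr_ge0 sinN sqrrN -opprD normrN; apply; exact: ltW.
rewrite ger0_norm ?subr_ge0 ?ge0_sin_le//.
move: x0; rewrite le_eqVlt => /predU1P[<-|x0].
  by rewrite sin0 subrr expr0n.
have [|c] := @MVT R sin cos 0 x x0.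
  exact/continuous_subspaceT/continuous_sin.
rewrite sin0 !subr0 in_itv/= => /andP[c0 cx] ->.
rewrite -{1}(mul1r x) -mulrBl expr2 ler_wpM2r ?(ltW x0)//.
by rewrite (le_trans (one_sub_cos_le_norm c))// gtr0_norm// ltW.
Qed.

Lemma one_sub_expRN_le x : 1 - expR (- x) <= x.
Proof. by have := expR_ge1Dx (- x); lra. Qed.

End elementary.

(** * Exchange of integrals over rectangles, and scaling *)

Section fubini_on_rectangles.
Context d1 d2 (T1 : measurableType d1) (T2 : measurableType d2) (R : realType).
Variables (m1 : {sigma_finite_measure set T1 -> \bar R}).
Variables (m2 : {sigma_finite_measure set T2 -> \bar R}).
Variables (D : set T1) (E : set T2) (f : T1 * T2 -> \bar R).
Hypotheses (mD : measurable D) (mE : measurable E).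
Hypothesis mf : measurable_fun setT f.
Local Open Scope ereal_scope.

(** An integral over a rectangle is the integral over the whole product of the
    integrand extended by zero. *)
Let integral_patchX (g : T1 * T2 -> \bar R) x :
  \int[m2]_y (g \_ (D `*` E)) (x, y) =
  ((fun x => \int[m2]_(y in E) g (x, y)) \_ D) x.
Proof.
rewrite [RHS]patchE; case: ifPn => [|] xD.
  rewrite [RHS]integral_mkcond; apply: eq_integral => y _; rewrite !patchE.
  by rewrite in_setX xD.
by apply: integral0_eq => y _; rewrite patchE in_setX (negbTE xD).
Qed.

Let integral_patchX' (g : T1 * T2 -> \bar R) y :
  \int[m1]_x (g \_ (D `*` E)) (x, y) =
  ((fun y => \int[m1]_(x in D) g (x, y)) \_ E) y.
Proof.
rewrite [RHS]patchE; case: ifPn => [|] yE.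
  rewrite [RHS]integral_mkcond; apply: eq_integral => x _; rewrite !patchE.
  by rewrite in_setX yE andbT.
by apply: integral0_eq => x _; rewrite patchE in_setX (negbTE yE) andbF.
Qed.

Let mpatch : measurable_fun setT (f \_ (D `*` E)).
Proof.
apply/(measurable_restrictT f); first exact: measurableX.
exact: measurable_funS mf.
Qed.

Lemma fubini_tonelli_setX :
  (forall x y, D x -> E y -> 0 <= f (x, y)) ->
  \int[m1]_(x in D) \int[m2]_(y in E) f (x, y) =
  \int[m2]_(y in E) \int[m1]_(x in D) f (x, y).
Proof.
move=> f0; rewrite integral_mkcond [RHS]integral_mkcond.
under eq_integral do rewrite -integral_patchX.
under [RHS]eq_integral do rewrite -integral_patchX'.
apply: fubini_tonelli => // -[x y]; apply: erestrict_ge0 => -[x' y'] /= [].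
exact: f0.
Qed.

Lemma Fubini_setX :
  \int[m1]_(x in D) \int[m2]_(y in E) `|f (x, y)| < +oo ->
  \int[m1]_(x in D) \int[m2]_(y in E) f (x, y) =
  \int[m2]_(y in E) \int[m1]_(x in D) f (x, y).
Proof.
move=> foo; rewrite integral_mkcond [RHS]integral_mkcond.
under eq_integral do rewrite -integral_patchX.
under [RHS]eq_integral do rewrite -integral_patchX'.
apply: Fubini; apply/integrable12ltyP => //.
apply: le_lt_trans foo; rewrite [leRHS]integral_mkcond.
under [leRHS]eq_integral do rewrite -(integral_patchX (fun z => `|f z|)).
rewrite (_ : (fun x => _) = (fun x => \int[m2]_y ((fun z => `|f z|) \_ (D `*` E)) (x, y)))//.
apply/funext => x; apply: eq_integral => y _.
by rewrite !patchE; case: ifP => _ //; rewrite abse0.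
Qed.

Lemma measurable_fun_integral_abs (A : set T1) :
  measurable_fun A (fun x => \int[m2]_(y in E) `|f (x, y)|).
Proof.
apply: measurable_funTS.
have mg : measurable_fun setT ((abse \o f) \_ (setT `*` E)).
  apply/(measurable_restrictT (abse \o f)); first exact: measurableX.
  exact/measurable_funTS/measurableT_comp.
rewrite (_ : (fun x => _) =
    fubini_F m2 ((abse \o f) \_ (setT `*` E))); last first.
  apply/funext => x; rewrite /fubini_F [LHS]integral_mkcond.
  by apply: eq_integral => y _; rewrite !patchE in_setX in_setT.
apply: measurable_fun_fubini_tonelli_F => // z.
by rewrite patchE; case: ifP => //=; rewrite abse_ge0.
Qed.

End fubini_on_rectangles.

Section scaling.
Context {R : realType}.
Notation mu := (@lebesgue_measure R).
Local Open Scope ereal_scope.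

(** Lebesgue measure is characterized by its values on half-open intervals. *)
Lemma lebesgue_measure_scale (l : R) (A : set R) : (0 < l)%R -> measurable A ->
  mu A = l%:E * pushforward mu ( *%R l : _ -> measurableTypeR R) A.
Proof.
move=> l0 mA.
pose l' : {nonneg R} := NngNum (ltW l0).
rewrite (_ : l%:E * _ = mscale l' (pushforward mu ( *%R l : _ -> measurableTypeR R)) A)//.
apply: lebesgue_measure_unique => //= _ [[a b]] _ <-.
have lE : ( *%R l) @^-1` `]a, b] = `](a / l)%R, (b / l)%R]%classic.
  by apply/seteqP; split => x /=; rewrite !in_itv/= ltr_pdivrMr// ler_pdivlMr// (mulrC x).
transitivity (l%:E * mu (( *%R l) @^-1` `]a, b])) => //.
rewrite lE !lebesgue_measure_itv/= !lte_fin ltr_pM2r ?invr_gt0//.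
case: ifPn => ab; last by rewrite mule0.
by rewrite -EFinB -EFinM -mulrBl mulrC divfK ?gt_eqF.
Qed.

Lemma ge0_integral_scale (l : R) (f : R -> \bar R) : (0 < l)%R ->
  measurable_fun setT f -> (forall x, 0 <= f x) ->
  \int[mu]_(x in `]0%R, +oo[) f (l * x)%R =
  l^-1%:E * \int[mu]_(x in `]0%R, +oo[) f x.
Proof.
move=> l0 mf f0.
have -> : \int[mu]_(x in `]0%R, +oo[) f x =
    l%:E * \int[mu]_(x in `]0%R, +oo[) f (l * x)%R.
  pose l' : {nonneg R} := NngNum (ltW l0).
  have ml : measurable_fun setT ( *%R l : measurableTypeR R -> measurableTypeR R).
    exact: mulrl_measurable.
  have mD : measurable (`]0%R, +oo[%classic : set (measurableTypeR R)) by [].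
  have mfD : measurable_fun (`]0%R, +oo[%classic : set (measurableTypeR R)) f.
    exact: measurable_funS mf.
  have := ge0_integral_pushforward ml mu mD mfD (fun x _ => f0 x).
  rewrite (_ : _ @^-1` _ = `]0%R, +oo[%classic); last first.
    by apply/seteqP; split => x /=; rewrite !in_itv/= !andbT pmulr_rgt0.
  rewrite /comp /= => <-; rewrite -[RHS](ge0_integral_mscale _ mD l' mfD)//.
  by apply: eq_measure_integral => A mA _; exact: lebesgue_measure_scale.
by rewrite muleA -EFinM mulVf ?gt_eqF// mul1e.
Qed.

End scaling.

(** * Integrals by antiderivatives *)

Section power_substitution.
Context {R : realType}.
Notation mu := (@lebesgue_measure R).

Lemma integral_is_derive (f F : R -> R) (a b : R) : a < b ->
  (forall x : R, is_derive x 1 F (f x)) -> continuous f ->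
  (\int[mu]_(x in `[a, b]) (f x)%:E = (F b - F a)%:E)%E.
Proof.
move=> ab dF cf.
have cF : continuous F.
  move=> x; apply: differentiable_continuous; apply/derivable1_diffP.
  exact: (@ex_derive _ _ _ _ _ _ _ (dF x)).
rewrite EFinB; apply: continuous_FTC2 => //.
- exact: continuous_subspaceT.
- split => //.
  + apply: cvg_at_right_filter; exact: cF.
  + apply: cvg_at_left_filter; exact: cF.
- by move=> x _; rewrite derive1E derive_val.
Qed.

Lemma powR_cvgy (a : R) : 1 <= a -> x `^ a @[x --> +oo] --> +oo.
Proof.
move=> a1; apply/cvgryPge => M; near=> x.
have Mx : M <= x by near: x; apply: nbhs_pinfty_ge; rewrite num_real.
have x1 : 1 <= x by near: x; apply: nbhs_pinfty_ge; rewrite num_real.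
by rewrite (le_trans Mx)// le1r_powR.
Unshelve. all: by end_near. Qed.

Lemma powR_right_continuous0 (a : R) : 0 <= a ->
  x `^ a @[x --> 0^'+] --> 0 `^ a.
Proof.
rewrite le_eqVlt => /predU1P[<-|a0].
  rewrite powRr0; under eq_fun do rewrite powRr0.
  exact: cvg_cst.
by rewrite powR0 ?gt_eqF//; exact: powR_cvg0.
Qed.

Lemma powR_continuous_gt0 (a x : R) : 0 < x -> {for x, continuous (fun y => y `^ a)}.
Proof.
move=> x0; apply: differentiable_continuous; apply/derivable1_diffP.
by apply: ex_derive; exact: is_derive1_powR.
Qed.

(** The change of variable [z = x `^ a], proved through the antiderivative
    [x |-> H (x `^ a) / a].  With [1 <= a] the weight [x `^ (a - 1)] stays
    continuous at [0]. *)
Lemma integral_powR_subst (h H : R -> R) (a l : R) : 1 <= a ->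
  (forall x : R, is_derive x 1 H (h x)) -> continuous h -> (forall x, 0 <= h x) ->
  H x @[x --> +oo] --> l ->
  (\int[mu]_(x in `]0%R, +oo[) (x `^ (a - 1) * h (x `^ a))%:E =
    ((l - H 0) / a)%:E)%E.
Proof.
move=> a1 dH ch h0 Hl.
have a0 : 0 < a by exact: lt_le_trans a1.
have cH : continuous H.
  move=> x; apply: differentiable_continuous; apply/derivable1_diffP.
  exact: (@ex_derive _ _ _ _ _ _ _ (dH x)).
pose F x := H (x `^ a) / a.
have dF (x : R) : 0 < x -> is_derive x 1 F (x `^ (a - 1) * h (x `^ a)).
  move=> x0; rewrite /F.
  have := @is_derive1_comp _ H (fun y => y `^ a) x _ _ (dH (x `^ a)) (is_derive1_powR a x0).
  move=> d; have := is_deriveM d (is_derive_cst a^-1 x 1).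
  rewrite scaler0 add0r => d2.
  apply: (@is_derive_eq _ _ _ _ _ _ _ _ d2).
  rewrite /GRing.scale/=; field; exact: lt0r_neq0.
have mfun : measurable_fun (`]0, +oo[%classic : set R) (fun x => (x `^ (a - 1) * h (x `^ a))%:E).
  apply/measurable_EFinP; apply: measurable_funM.
    by apply: measurable_funTS; exact: measurable_powR.
  apply: measurableT_comp; first exact: continuous_measurable_fun.
  by apply: measurable_funTS; exact: measurable_powR.
rewrite integral_itv_obnd_cbnd//.
rewrite (@ge0_continuous_FTC2y _ _ F 0 (l / a)).
- by rewrite -EFinB /F powR0 ?gt_eqF// mulrBl.
- by move=> x x0; rewrite mulr_ge0// powR_ge0.
- apply/continuous_within_itvcyP; split.
    move=> x; rewrite in_itv/= andbT => x0.
    apply: cvgM; first exact: powR_continuous_gt0.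
    apply: (@cvg_comp _ _ _ (fun x => x `^ a) h); last exact: ch.
    exact: powR_continuous_gt0.
  apply: cvgM; first by apply: powR_right_continuous0; rewrite subr_ge0.
  apply: (@cvg_comp _ _ _ (fun x => x `^ a) h); last exact: ch.
  by apply: powR_right_continuous0; exact: ltW.
- apply: cvgM; last exact: cvg_cst.
  by apply: (@cvg_comp _ _ _ (fun x => x `^ a) H); [exact: powR_cvgy|].
- by move=> x /dF dFx; exact: (@ex_derive _ _ _ _ _ _ _ dFx).
- apply: cvgM; last exact: cvg_cst.
  apply: (@cvg_comp _ _ _ (fun x => x `^ a) H); last exact: cH.
  by apply: powR_right_continuous0; exact: ltW.
- move=> x; rewrite in_itv/= andbT => /dF dFx.
  by rewrite derive1E (@derive_val _ _ _ _ _ _ _ dFx).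
Qed.

Lemma cvgr_expRM (c : R) : 0 < c -> expR (- (c * x)) @[x --> +oo] --> 0.
Proof.
move=> c0; apply: (@cvg_comp _ _ _ (fun x => c * x) (fun x => expR (- x))).
  2: exact: cvgr_expR.
apply/cvgryPge => M; near=> x.
rewrite -ler_pdivrMl//; near: x; apply: nbhs_pinfty_ge; rewrite num_real.
Unshelve. all: by end_near. Qed.

Lemma integral_expR_powR (a c : R) : 1 <= a -> 0 < c ->
  (\int[mu]_(x in `]0%R, +oo[) (x `^ (a - 1) * expR (- (c * x `^ a)))%:E =
    (c^-1 / a)%:E)%E.
Proof.
move=> a1 c0.
pose h z := expR (- (c * z)).
pose H z := - c^-1 * expR (- (c * z)).
have dH (x : R) : is_derive x 1 H (h x).
  apply: is_derive_eq; rewrite /h /GRing.scale/=; field; exact: lt0r_neq0.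
have ch : continuous h.
  by move=> x; apply: differentiable_continuous; exact/derivable1_diffP.
have h0 x : 0 <= h x by exact: expR_ge0.
have Hl : H x @[x --> +oo] --> 0.
  rewrite -[X in _ --> X](mulr0 (- c^-1)); apply: cvgM; first exact: cvg_cst.
  exact: cvgr_expRM.
rewrite (integral_powR_subst a1 dH ch h0 Hl).
by rewrite /H mulr0 oppr0 expR0 mulr1 sub0r opprK.
Qed.

(** Adding [1] to the cosine makes the integrand nonnegative, so that the
    fundamental theorem of calculus on a half-line applies; the cosine integral
    itself is recovered by subtraction in [integral_expR_powR_cos]. *)
Lemma integral_expR_powR_cos1 (a c y : R) : 1 <= a -> 0 < c ->
  (\int[mu]_(x in `]0%R, +oo[)
     (x `^ (a - 1) * (expR (- (c * x `^ a)) * (1 + cos (y * x `^ a))))%:E =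
    ((c^-1 + c / (c ^+ 2 + y ^+ 2)) / a)%:E)%E.
Proof.
move=> a1 c0.
have cy0 : c ^+ 2 + y ^+ 2 != 0.
  by rewrite gt_eqF// ltr_wpDr ?sqr_ge0// exprn_gt0.
(* [expR (- (c * z)) * K z] is the antiderivative of
   [expR (- (c * z)) * (1 + cos (y * z))] that vanishes at infinity. *)
pose K z := - c^-1 + (- c * cos (y * z) + y * sin (y * z)) / (c ^+ 2 + y ^+ 2).
pose h z := expR (- (c * z)) * (1 + cos (y * z)).
pose H z := expR (- (c * z)) * K z.
have dH (x : R) : is_derive x 1 H (h x).
  rewrite /H /h /K; apply: is_derive_eq.
  rewrite /GRing.scale/= !(mulr1, mulr0, addr0, add0r); field.
  by rewrite cy0/=; exact: lt0r_neq0.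
have ch : continuous h.
  by move=> x; apply: differentiable_continuous; exact/derivable1_diffP.
have h0 x : 0 <= h x.
  by rewrite mulr_ge0 ?expR_ge0//; have := cos_geN1 (y * x); lra.
have Hl : H x @[x --> +oo] --> 0.
  apply: (@squeeze_cvgr _ _ _ _ (fun z => - ((c^-1 + (c + `|y|) / (c ^+ 2 + y ^+ 2)) * expR (- (c * z))))
      (fun z => (c^-1 + (c + `|y|) / (c ^+ 2 + y ^+ 2)) * expR (- (c * z)))).
  + near=> z; rewrite -ler_norml normrM (ger0_norm (expR_ge0 _)) mulrC.
    rewrite ler_wpM2r ?expR_ge0// /K (le_trans (ler_normD _ _))//.
    apply: lerD; first by rewrite normrN gtr0_norm ?invr_gt0.
    rewrite normrM [X in _ * X]ger0_norm ?invr_ge0 ?addr_ge0 ?sqr_ge0//.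
    rewrite ler_wpM2r ?invr_ge0 ?addr_ge0 ?sqr_ge0//.
    rewrite (le_trans (ler_normD _ _))// !normrM normrN (ger0_norm (ltW c0)).
    by apply: lerD; rewrite ler_piMr ?cos_max ?sin_max// ltW.
  + rewrite -oppr0; apply: cvgN.
    rewrite -[X in _ --> X](mulr0 (c^-1 + (c + `|y|) / (c ^+ 2 + y ^+ 2))); apply: cvgM; first exact: cvg_cst.
    exact: cvgr_expRM.
  + rewrite -[X in _ --> X](mulr0 (c^-1 + (c + `|y|) / (c ^+ 2 + y ^+ 2))); apply: cvgM; first exact: cvg_cst.
    exact: cvgr_expRM.
rewrite (integral_powR_subst a1 dH ch h0 Hl).
rewrite /H !mulr0 oppr0 expR0 /K mulr0 sin0 cos0; congr (EFin (_ / _)).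
by field; rewrite cy0/=; exact: lt0r_neq0.
Unshelve. all: by end_near. Qed.

End power_substitution.

(** * Damped sine and cosine integrals *)

Section arctan_integral.
Context {R : realType}.
Notation mu := (@lebesgue_measure R).
Notation D := (`]0%R, +oo[%classic : set R).

Lemma integrable_ge0_lty d (T : measurableType d) (m : {measure set T -> \bar R})
    (E : set T) (f : T -> \bar R) : measurable E -> measurable_fun E f ->
  (forall x, E x -> 0 <= f x)%E -> (\int[m]_(x in E) f x < +oo)%E ->
  m.-integrable E f.
Proof.
move=> mE mf f0 foo; apply/integrableP; split => //.
rewrite (eq_integral f)// => x; rewrite inE => /f0 fx0.
by rewrite gee0_abs.
Qed.

Lemma measurable_cos_comp d (T : measurableType d) (E : set T) (f : T -> R) :
  measurable_fun E f -> measurable_fun E (fun x => cos (f x)).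
Proof.
by apply: measurableT_comp; apply: continuous_measurable_fun; exact: continuous_cos.
Qed.

Lemma measurable_sin_comp d (T : measurableType d) (E : set T) (f : T -> R) :
  measurable_fun E f -> measurable_fun E (fun x => sin (f x)).
Proof.
by apply: measurableT_comp; apply: continuous_measurable_fun; exact: continuous_sin.
Qed.

Lemma measurable_expR_comp d (T : measurableType d) (E : set T) (f : T -> R) :
  measurable_fun E f -> measurable_fun E (fun x => expR (f x)).
Proof. exact: measurableT_comp. Qed.

Lemma measurable_powR_comp d (T : measurableType d) (E : set T) (f : T -> R) p :
  measurable_fun E f -> measurable_fun E (fun x => f x `^ p).
Proof.
by move=> mf; apply: (measurableT_comp (f := @powR R ^~ p)) => //; exact: measurable_powR.
Qed.

Lemma measurable_invr_comp d (T : measurableType d) (E : set T) (f : T -> R) :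
  (forall x, 0 <= f x) -> measurable_fun E f ->
  measurable_fun E (fun x => (f x)^-1).
Proof.
move=> f0 mf; apply: eq_measurable_fun (measurable_powR_comp (-1) mf) => x _.
by rewrite powR_inv1.
Qed.

Lemma measurable_atan_comp d (T : measurableType d) (E : set T) (f : T -> R) :
  measurable_fun E f -> measurable_fun E (fun x => atan (f x)).
Proof.
apply: measurableT_comp; apply: continuous_measurable_fun => x.
exact: continuous_atan.
Qed.

Lemma measurable_sg_comp d (T : measurableType d) (E : set T) (f : T -> R) :
  measurable_fun E f -> measurable_fun E (fun x => Num.sg (f x)).
Proof.
apply: measurableT_comp; apply: nondecreasing_measurable => // x y xy.
have [x0|x0|x0] := ltgtP x 0; have [y0|y0|y0] := ltgtP y 0;
  rewrite ?(ltr0_sg x0) ?(gtr0_sg x0) ?(ltr0_sg y0) ?(gtr0_sg y0) ?x0 ?y0 ?sgr0//; lra.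
Qed.

Variables (a c : R).
Hypotheses (a1 : 1 <= a) (c0 : 0 < c).
Let a0 : 0 < a. Proof. exact: lt_le_trans a1. Qed.

Let w x : R := x `^ (a - 1) * expR (- (c * x `^ a)).

Let w_ge0 x : 0 <= w x.
Proof. by rewrite mulr_ge0 ?powR_ge0 ?expR_ge0. Qed.

Let measurable_w E : measurable_fun E w.
Proof.
apply: measurable_funM; first exact: measurable_powR_comp.
apply: measurable_expR_comp; apply: measurable_funN.
by apply: measurable_funM => //; exact: measurable_powR_comp.
Qed.

Lemma integrable_expR_powR : mu.-integrable D
  (fun x => (x `^ (a - 1) * expR (- (c * x `^ a)))%:E).
Proof.
apply: integrable_ge0_lty => //; first by apply/measurable_EFinP; exact: measurable_w.
  by move=> x _; rewrite lee_fin w_ge0.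
by rewrite integral_expR_powR// ltry.
Qed.

Lemma integral_expR_powR_cos (y : R) :
  (\int[mu]_(x in D) (w x * cos (y * x `^ a))%:E =
    (c / (c ^+ 2 + y ^+ 2) / a)%:E)%E.
Proof.
have mc : measurable_fun D (fun x => cos (y * x `^ a)).
  apply: measurable_cos_comp; apply: measurable_funM => //.
  exact: measurable_powR_comp.
have iw := integrable_expR_powR.
have E1 := integral_expR_powR_cos1 y a1 c0.
have i1 : mu.-integrable D (fun x =>
    (x `^ (a - 1) * (expR (- (c * x `^ a)) * (1 + cos (y * x `^ a))))%:E).
  apply: integrable_ge0_lty => //; last by rewrite E1 ltry.
    apply/measurable_EFinP; apply: measurable_funM.
      exact: measurable_powR_comp.
    apply: measurable_funM.
      apply: measurable_expR_comp; apply: measurable_funN.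
      by apply: measurable_funM => //; exact: measurable_powR_comp.
    exact: measurable_funD.
  move=> x _; rewrite lee_fin mulrA mulr_ge0 ?w_ge0//.
transitivity (\int[mu]_(x in D)
    ((x `^ (a - 1) * (expR (- (c * x `^ a)) * (1 + cos (y * x `^ a))))%:E -
    (x `^ (a - 1) * expR (- (c * x `^ a)))%:E))%E.
  by apply: eq_integral => x _; rewrite -EFinB /w; congr EFin; ring.
rewrite integralB_EFin// E1 integral_expR_powR// -EFinB; congr EFin.
by rewrite mulrDl addrC addKr.
Qed.

(** [sin (b z) / z] is the integral of [cos (y z)] over [y] in [[0, b]]; here
    [z = x `^ a]. *)
Let sincE b x : 0 < x ->
  expR (- (c * x `^ a)) * (sin (b * x `^ a) * x `^ (-1)) =
  w x * (sin (b * x `^ a) / (x `^ a)).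
Proof.
move=> x0; rewrite /w; set e := expR _; set s := sin _.
rewrite -(mulr_powRB1 (ltW x0) a0) powR_inv1 ?ltW//.
have xa : x `^ (a - 1) != 0 by rewrite gt_eqF ?powR_gt0.
by field; rewrite xa gt_eqF.
Qed.

Lemma integrable_expR_sinc (b : R) : mu.-integrable D
  (fun x => (expR (- (c * x `^ a)) * (sin (b * x `^ a) * x `^ (-1)))%:E).
Proof.
apply: (@le_integrable _ _ _ mu _ _ _ (fun x => (`|b| * w x)%:E)) => //.
- apply/measurable_EFinP; apply: measurable_funM.
    apply: measurable_expR_comp; apply: measurable_funN.
    by apply: measurable_funM => //; exact: measurable_powR_comp.
  apply: measurable_funM; last exact: measurable_powR_comp.
  apply: measurable_sin_comp; apply: measurable_funM => //.
  exact: measurable_powR_comp.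
- move=> x /=; rewrite in_itv/= andbT => x0; rewrite lee_fin sincE//.
  rewrite [leRHS](ger0_norm (mulr_ge0 (normr_ge0 b) (w_ge0 x))) normrM (ger0_norm (w_ge0 x)).
  rewrite mulrC ler_wpM2r ?w_ge0// normrM normfV.
  rewrite ler_pdivrMr ?normr_gt0 ?gt_eqF ?powR_gt0//.
  by rewrite -normrM norm_sin_le.
- apply: (@integrableZl _ _ _ mu _ _ `|b| (EFin \o w)) => //.
  exact: integrable_expR_powR.
Qed.

(** Writing the sine as an integral of cosines and exchanging the integrals
    leaves the integral of [c / (c ^+ 2 + y ^+ 2) / a] over [y] in [[0, b]],
    which is an arctangent.  The exponent [a = 1] is used for the regularized
    sign of a variable, the stability index for its characteristic function;
    inverse powers are written [x `^ (-1)], which is measurable in [x]. *)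
Lemma integral_expR_sinc (b : R) :
  (\int[mu]_(x in D)
    (expR (- (c * x `^ a)) * (sin (b * x `^ a) * x `^ (-1)))%:E =
    (atan (b / c) / a)%:E)%E.
Proof.
wlog b0 : b / 0 < b => [hw|].
  have [b0|b0|->] := ltgtP b 0; last 2 first.
  - exact: hw.
  - rewrite mul0r atan0 mul0r; apply: integral0_eq => x _.
    by rewrite mul0r sin0 mul0r mulr0.
  - have -> : atan (b / c) / a = - (atan (- b / c) / a).
      by rewrite !mulNr atanN mulNr opprK.
    rewrite EFinN -hw ?oppr_gt0// -integralN/=; last first.
      exact: integrable_add_def (integrable_expR_sinc (- b)).
    apply: eq_integral => x _.
    by congr EFin; rewrite mulNr sinN mulNr mulrN opprK.
pose f (z : R * R) : \bar R := (w z.1 * cos (z.2 * z.1 `^ a))%:E.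
have mf : measurable_fun setT f.
  apply/measurable_EFinP; apply: measurable_funM.
    by apply: measurableT_comp => //; exact: measurable_w.
  apply: measurable_cos_comp; apply: measurable_funM => //.
  by apply: measurable_powR_comp.
have mi : measurable (`[0, b]%classic : set R) by [].
have foo : (\int[mu]_(x in D) \int[mu]_(y in `[0%R, b]) `|f (x, y)| < +oo)%E.
  apply: (@le_lt_trans _ _ (\int[mu]_(x in D) ((w x)%:E * b%:E))%E); last first.
    rewrite ge0_integralZr//.
    - by rewrite integral_expR_powR// -EFinM ltry.
    - by apply/measurable_EFinP; exact: measurable_w.
    - by move=> x _; rewrite lee_fin w_ge0.
    - by rewrite lee_fin ltW.
  apply: ge0_le_integral => //.
  - by move=> x _; exact: integral_ge0.
  - exact: measurable_fun_integral_abs.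
  - apply/measurable_EFinP; apply: measurable_funM => //; exact: measurable_w.
  - move=> x _.
    apply: (@le_trans _ _ (\int[mu]_(y in `[0%R, b]) (cst (w x)%:E y))%E).
      apply: ge0_le_integral => //.
        apply: measurableT_comp => //.
        apply: measurable_funTS; apply: measurableT_comp => //.
      move=> y _; rewrite /f/= lee_fin normrM (ger0_norm (w_ge0 x)).
      by rewrite ler_piMr ?w_ge0 ?cos_max.
    rewrite integral_cst//= lebesgue_measure_itv/= lte_fin b0.
    by rewrite -EFinB subr0.
transitivity (\int[mu]_(x in D) \int[mu]_(y in `[0%R, b]) f (x, y))%E.
  apply: eq_integral => x; rewrite inE/= in_itv/= andbT => x0.
  rewrite sincE//= /f/=.
  have xa : x `^ a != 0 by rewrite gt_eqF ?powR_gt0.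
  pose F y := w x * (sin (y * x `^ a) / x `^ a).
  have dF (y : R) : is_derive y 1 F (w x * cos (y * x `^ a)).
    rewrite /F; apply: is_derive_eq.
    by rewrite /GRing.scale/= !(mulr1, mulr0, addr0, add0r); field.
  rewrite (integral_is_derive b0 dF); last first.
    by move=> y; apply: differentiable_continuous; exact/derivable1_diffP.
  by rewrite /F mul0r sin0 mul0r mulr0 subr0.
rewrite Fubini_setX//.
under eq_integral do rewrite /f/= integral_expR_powR_cos.
have c2 y : c ^+ 2 + y ^+ 2 != 0.
  by rewrite gt_eqF// ltr_wpDr ?sqr_ge0// exprn_gt0.
pose F y := atan (y / c) / a.
have dF (y : R) : is_derive y 1 F (c / (c ^+ 2 + y ^+ 2) / a).
  rewrite /F; apply: is_derive_eq.
  rewrite /GRing.scale/= !(mulr1, mulr0, addr0, add0r); field.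
  by rewrite c2 !gt_eqF//= -exprMn; apply/andP; split => //; rewrite addrC c2.
rewrite (integral_is_derive b0 dF)//.
  by rewrite /F mul0r atan0 mul0r subr0.
move=> y; apply: cvgM; last exact: cvg_cst.
apply: cvgM; first exact: cvg_cst.
apply: cvgV => //; apply: cvgD; first exact: cvg_cst.
exact: exprn_continuous.
Qed.

End arctan_integral.

Section laplace_transforms.
Context {R : realType}.
Notation mu := (@lebesgue_measure R).
Notation D := (`]0%R, +oo[%classic : set R).
Variable c : R.
Hypothesis c0 : 0 < c.

Lemma integrable_laplace : mu.-integrable D (fun x => (expR (- (c * x)))%:E).
Proof.
apply: eq_integrable (integrable_expR_powR (lexx 1) c0) => //.
move=> x; rewrite inE/= in_itv/= andbT => x0.
by rewrite subrr powRr0 mul1r powRr1 ?ltW.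
Qed.

Lemma integral_laplace :
  (\int[mu]_(x in D) (expR (- (c * x)))%:E = (c^-1)%:E)%E.
Proof.
rewrite -[in RHS](divr1 c^-1) -(integral_expR_powR (lexx 1) c0).
apply: eq_integral => x; rewrite inE/= in_itv/= andbT => x0.
by rewrite subrr powRr0 mul1r powRr1 ?ltW.
Qed.

Lemma integral_laplace_cos (y : R) :
  (\int[mu]_(x in D) (expR (- (c * x)) * cos (y * x))%:E =
    (c / (c ^+ 2 + y ^+ 2))%:E)%E.
Proof.
rewrite -[in RHS](divr1 (c / _)) -(integral_expR_powR_cos (lexx 1) c0).
apply: eq_integral => x; rewrite inE/= in_itv/= andbT => x0.
by rewrite subrr powRr0 mul1r powRr1 ?ltW.
Qed.

Lemma integral_laplace_sinc (y : R) :
  (\int[mu]_(x in D) (expR (- (c * x)) * (sin (y * x) * x `^ (-1)))%:E =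
    (atan (y / c))%:E)%E.
Proof.
rewrite -[in RHS](divr1 (atan _)) -(integral_expR_sinc (lexx 1) c0).
apply: eq_integral => x; rewrite inE/= in_itv/= andbT => x0.
by rewrite [x `^ 1]powRr1 ?ltW.
Qed.

End laplace_transforms.

(** * The kernel of the absolute value *)

Section inverse_square_kernel.
Context {R : realType}.
Notation mu := (@lebesgue_measure R).
Notation D := (`]0%R, +oo[%classic : set R).

(** The factor [l] that comes out is what turns a self-similar characteristic
    function into a self-similar first absolute moment. *)
Lemma integral_inv2_scale (g : R -> R) (l : R) : 0 < l ->
  measurable_fun setT g -> (forall x, 0 <= g x) ->
  (\int[mu]_(x in D) (g (l * x) * x `^ (-2))%:E =
   l%:E * \int[mu]_(x in D) (g x * x `^ (-2))%:E)%E.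
Proof.
move=> l0 mg g0.
pose f x := (g x * x `^ (-2))%:E.
have mf : measurable_fun setT f.
  by apply/measurable_EFinP; apply: measurable_funM => //; exact: measurable_powR.
have f0 x : (0 <= f x)%E by rewrite lee_fin mulr_ge0// powR_ge0.
have := ge0_integral_scale l0 mf f0; rewrite -/(f _).
move=> /(congr1 (fun z => (l ^+ 2)%:E * z)%E); rewrite muleA -EFinM.
rewrite (_ : l ^+ 2 * l^-1 = l); last by field; exact: lt0r_neq0.
move=> <-; rewrite -ge0_integralZl_EFin ?sqr_ge0//; last first.
  apply: measurable_funTS; apply: measurableT_comp => //.
apply: eq_integral => x; rewrite inE/= in_itv/= andbT => x0.
rewrite /f -EFinM; congr EFin.
rewrite powRM ?ltW// (powR_invn 2 (ltW l0)).
by field; exact: lt0r_neq0.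
Qed.

(** The integrand may blow up at [0], so the integral is the limit of those over
    [[1 / n, 1]], which an antiderivative bounds uniformly. *)
Lemma integral_powR_01 (q : R) : -1 < q ->
  (\int[mu]_(x in `]0%R, 1%R]) (x `^ q)%:E < +oo)%E.
Proof.
move=> q1.
have q10 : 0 < q + 1 by rewrite -ltrBlDr sub0r.
pose F n : set R := `[n.+1%:R^-1, 1]%classic.
have -> : `]0, 1]%classic = \bigcup_n F n.
  apply/seteqP; split => x /=.
    rewrite in_itv/= => /andP[x0 x1].
    have [n /[!add0r] nx] := ltr_add_invr x0.
    by exists n; rewrite // /F/= in_itv/= x1 andbT ltW.
  move=> [n _]; rewrite /F/= !in_itv/= => /andP[nx ->]; rewrite andbT.
  exact: lt_le_trans nx.
have Fnd : nondecreasing_seq F.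
  move=> m n mn; apply/subsetPset => x; rewrite /F/= !in_itv/= => /andP[mx ->].
  by rewrite andbT (le_trans _ mx)// lef_pV2 ?posrE// ler_nat.
have mF i : measurable (F i) by exact: measurable_itv.
have mp i : measurable_fun (F i) (fun x : R => (x `^ q)%:E).
  by apply/measurable_EFinP; exact: measurable_powR_comp.
have cvgF : (\int[mu]_(x in F n) (x `^ q)%:E @[n --> \oo] -->
    \int[mu]_(x in \bigcup_n F n) (x `^ q)%:E)%E.
  apply: ge0_nondecreasing_set_cvg_integral => //.
  by move=> i x _; rewrite lee_fin powR_ge0.
rewrite -(cvg_lim _ cvgF)//; apply: (@le_lt_trans _ _ ((q + 1)^-1)%:E); last first.
  exact: ltry.
apply: lime_le; first by apply/cvg_ex; eexists; exact: cvgF.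
apply: nearW => n.
case: n => [|n].
  rewrite /F invr1 set_itv1 integral_set1 lee_fin invr_ge0; exact: ltW.
have n0 : (0 : R) < n.+2%:R^-1 by rewrite invr_gt0.
have pos (x : R) : x \in `[n.+2%:R^-1, 1] -> 0 < x.
  by rewrite in_itv/= => /andP[+ _]; exact: lt_le_trans.
pose G (y : R) := y `^ (q + 1) / (q + 1).
have dF (x : R) : 0 < x -> is_derive x 1 G (x `^ q).
  move=> x0; apply: (@is_derive_eq _ _ _ _ _ _ _ _
    (is_deriveM (is_derive1_powR (q + 1) x0) (is_derive_cst (q + 1)^-1 x 1))).
  rewrite scaler0 add0r addrK /GRing.scale/=; field; exact: lt0r_neq0.
have cG (x : R) : 0 < x -> G y @[y --> x] --> G x.
  move=> /dF dGx; apply: differentiable_continuous; apply/derivable1_diffP.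
  exact: (@ex_derive _ _ _ _ _ _ _ dGx).
rewrite /F (@continuous_FTC2 _ _ G).
- rewrite /G; by rewrite powR1 mul1r -EFinB lee_fin gerBl divr_ge0 ?powR_ge0// ltW.
- by rewrite invf_lt1// ltr1n.
- apply: derivable_within_continuous => x /pos x0.
  by apply: ex_derive; exact: is_derive1_powR.
- split.
  + move=> x xi; have x0 : 0 < x by apply: pos; exact: subset_itv_oo_cc xi.
    exact: (@ex_derive _ _ _ _ _ _ _ (dF _ x0)).
  + by apply: cvg_at_right_filter; exact: cG.
  + by apply: cvg_at_left_filter; exact: cG.
- move=> x xi; have x0 : 0 < x by apply: pos; exact: subset_itv_oo_cc xi.
  by rewrite derive1E (@derive_val _ _ _ _ _ _ _ (dF _ x0)).
Qed.

Lemma integral_inv2_1y : (\int[mu]_(x in `]1%R, +oo[) (x `^ (-2))%:E < +oo)%E.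
Proof.
rewrite integral_itv_obnd_cbnd; last first.
  by apply/measurable_EFinP; exact: measurable_powR_comp.
pose G (y : R) := - y `^ (-1).
have dF (x : R) : 0 < x -> is_derive x 1 G (x `^ (-2)).
  move=> x0; apply: (@is_derive_eq _ _ _ _ _ _ _ _
    (is_deriveN (is_derive1_powR (-1) x0))).
  by rewrite mulN1r opprK; congr (_ `^ _); ring.
have cG (x : R) : 0 < x -> G y @[y --> x] --> G x.
  move=> /dF dGx; apply: differentiable_continuous; apply/derivable1_diffP.
  exact: (@ex_derive _ _ _ _ _ _ _ dGx).
rewrite (@ge0_continuous_FTC2y _ _ G 1 0) ?ltry//.
- by move=> x _; exact: powR_ge0.
- apply: derivable_within_continuous => x; rewrite in_itv/= andbT => x1.
  apply: ex_derive; apply: is_derive1_powR; exact: lt_le_trans x1.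
- rewrite -oppr0; apply: cvgN.
  apply: (@cvg_trans _ ((fun x : R => x^-1) @ +oo)).
    apply: near_eq_cvg; near=> x.
    have x0 : 0 <= x by near: x; apply: nbhs_pinfty_ge; rewrite num_real.
    by rewrite powR_inv1.
  apply/(@gtr0_cvgV0 _ _ _ _ id); last exact: cvg_id.
  by near=> x; near: x; apply: nbhs_pinfty_gt; rewrite num_real.
- move=> x x1; apply: (@ex_derive _ _ _ _ _ _ _ (dF _ _)).
  exact: lt_trans x1.
- by apply: cvg_at_right_filter; exact: cG.
- move=> x; rewrite in_itv/= andbT => x1.
  by rewrite derive1E (@derive_val _ _ _ _ _ _ _ (dF _ (lt_trans ltr01 x1))).
Unshelve. all: by end_near. Qed.

(** A bound of order [p > 1] at the origin compensates the kernel there, and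
    boundedness suffices at infinity. *)
Lemma integral_inv2_lty (g : R -> R) (K p : R) : 1 < p ->
  measurable_fun setT g -> (forall x, 0 <= g x) ->
  (forall x, 0 < x -> g x <= K) ->
  (forall x, 0 < x <= 1 -> g x <= K * x `^ p) ->
  (\int[mu]_(x in D) (g x * x `^ (-2))%:E < +oo)%E.
Proof.
move=> p1 mg g0 gK gp.
have K0 : 0 <= K by apply: (le_trans (g0 1)); exact: gK.
have -> : D = `]0, 1] `|` `]1, +oo[.
  by rewrite -itv_bndbnd_setU// bnd_simp.
have mgf E : measurable_fun E (fun x => (g x * x `^ (-2))%:E).
  apply/measurable_EFinP; apply: measurable_funM; first exact: measurable_funTS.
  exact: measurable_powR_comp.
rewrite ge0_integral_setU//; last 2 first.
  by move=> x _; rewrite lee_fin mulr_ge0// powR_ge0.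
  by rewrite disj_set2E; apply/eqP/seteqP; split => x //=; rewrite !in_itv/=; lra.
apply: lte_add_pinfty.
- apply: (@le_lt_trans _ _ (\int[mu]_(x in `]0%R, 1%R]) (K%:E * (x `^ (p - 2))%:E))%E).
    apply: ge0_le_integral => //.
    + by move=> x _; rewrite lee_fin mulr_ge0// powR_ge0.
    + exact: mgf.
    + by apply: measurable_funeM; apply/measurable_EFinP; exact: measurable_powR_comp.
    + move=> x; rewrite /= in_itv/= => /andP[x0 x1]; rewrite lee_fin.
      rewrite powRD; last by rewrite (gt_eqF x0) implybT.
      by rewrite mulrA ler_wpM2r ?powR_ge0// gp// x0.
  rewrite ge0_integralZl//.
  + by rewrite lte_mul_pinfty ?lee_fin// integral_powR_01//; lra.
  + by apply/measurable_EFinP; exact: measurable_powR_comp.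
  + by move=> x _; rewrite lee_fin powR_ge0.
- apply: (@le_lt_trans _ _ (\int[mu]_(x in `]1%R, +oo[) (K%:E * (x `^ (-2))%:E))%E).
    apply: ge0_le_integral => //.
    + by move=> x _; rewrite lee_fin mulr_ge0// powR_ge0.
    + exact: mgf.
    + by apply: measurable_funeM; apply/measurable_EFinP; exact: measurable_powR_comp.
    + move=> x; rewrite /= in_itv/= andbT => x1; rewrite lee_fin.
      by rewrite ler_wpM2r ?powR_ge0// gK// (lt_trans _ x1).
  rewrite ge0_integralZl//.
  + by rewrite lte_mul_pinfty ?lee_fin// integral_inv2_1y.
  + by apply/measurable_EFinP; exact: measurable_powR_comp.
  + by move=> x _; rewrite lee_fin powR_ge0.
- exact: mgf.
Qed.

End inverse_square_kernel.

(** * Stable characteristic functions *)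

Section stable_transform.
Context {R : realType}.
Notation mu := (@lebesgue_measure R).
Notation D := (`]0%R, +oo[%classic : set R).

(** The characteristic function of the normalized stable law of index [a] is
    [stable_re a k + i * stable_im a k] on the half-line [x >= 0]; the skewness
    is carried by [k], the tangent of the angle [atan k]. *)
Definition stable_re (a k x : R) : R := expR (- x `^ a) * cos (k * x `^ a).
Definition stable_im (a k x : R) : R := expR (- x `^ a) * sin (k * x `^ a).

Definition cos_kernel_mass : \bar R := \int[mu]_(x in D) ((1 - cos x) * x `^ (-2))%:E.

Definition stable_kernel_mass (a k : R) : \bar R :=
  \int[mu]_(x in D) ((1 - stable_re a k x) * x `^ (-2))%:E.

Lemma measurable_stable_re a k : measurable_fun setT (stable_re a k).
Proof.
apply: measurable_funM.
  apply: measurable_expR_comp; apply: measurable_funN; exact: measurable_powR.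
by apply: measurable_cos_comp; apply: measurable_funM => //; exact: measurable_powR.
Qed.

Lemma stable_re_le1 a k x : stable_re a k x <= 1.
Proof.
rewrite (le_trans (ler_norm _))// normrM ger0_norm ?expR_ge0//.
by rewrite mulr_ile1 ?expR_ge0 ?cos_max// expR_le1 oppr_le0 powR_ge0.
Qed.

Lemma cos_kernel_mass_lty : (cos_kernel_mass < +oo)%E.
Proof.
apply: (@integral_inv2_lty _ _ 2 2).
- by rewrite ltr1n.
- apply: measurable_funB => //; exact: measurable_cos_comp.
- exact: one_sub_cos_ge0.
- by move=> x _; exact: one_sub_cos_le2.
- move=> x /andP[x0 _]; rewrite (le_trans (one_sub_cos_le_sqr x))//.
  rewrite (powR_mulrn 2 (ltW x0)) ler_peMl ?sqr_ge0//.
  by rewrite ler1n.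
Qed.

(** On [[1, 2]] the integrand is at least [(1 - cos 1) / 4], which is positive
    as the cosine decreases on [[0, pi]]. *)
Lemma cos_kernel_mass_gt0 : (0 < cos_kernel_mass)%E.
Proof.
have mg E : measurable_fun E (fun x => ((1 - cos x) * x `^ (-2) : R)%:E).
  apply/measurable_EFinP; apply: measurable_funM; last exact: measurable_powR_comp.
  by apply: measurable_funB => //; exact: measurable_cos_comp.
apply: (@lt_le_trans _ _ (\int[mu]_(x in `[1%R, 2%R]) (cst ((1 - cos 1) / 4)%:E x))%E).
  rewrite integral_cst//= lebesgue_measure_itv/= lte_fin ltr1n/= -EFinB -EFinM lte_fin.
  apply: mulr_gt0; last by lra.
  rewrite divr_gt0// subr_gt0 -[ltRHS]cos0 ltr_cos// !in_itv/= ?lexx ?ler01 ?pi_ge0//.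
  by rewrite (le_trans _ (pi_ge2 _))// ler1n.
apply: (@le_trans _ _ (\int[mu]_(x in `[1%R, 2%R]) ((1 - cos x) * x `^ (-2))%:E)%E).
  apply: ge0_le_integral => //.
  - by move=> x _; rewrite lee_fin divr_ge0 ?one_sub_cos_ge0.
  - exact: mg.
  - move=> x /=; rewrite in_itv/= => /andP[x1 x2]; rewrite lee_fin.
    have x0 : 0 < x by exact: lt_le_trans x1.
    rewrite ler_pM ?one_sub_cos_ge0 ?invr_ge0//.
      rewrite lerD2l lerN2; move: x1; rewrite le_eqVlt => /predU1P[<-//|x1].
      have pi2 := pi_ge2 R.
      have i1 : (1 : R) \in `[0, pi] by rewrite in_itv/=; apply/andP; split; lra.
      have ix : x \in `[0, pi] by rewrite in_itv/=; apply/andP; split; lra.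
      by rewrite ltW// ltr_cos.
    rewrite (powR_invn 2 (ltW x0)) lef_pV2 ?posrE ?exprn_gt0//.
    rewrite (_ : 4 = 2 ^+ 2); last by rewrite -natrX.
    by rewrite lerXn2r ?nnegrE// ltW.
apply: ge0_subset_integral => //.
- exact: mg.
- by move=> x _; rewrite lee_fin mulr_ge0 ?powR_ge0 ?one_sub_cos_ge0.
- by move=> x /=; rewrite !in_itv/= andbT => /andP[x1 _]; exact: lt_le_trans x1.
Qed.

(** Near [0], [1 - stable_re a k x] is of order [x `^ a] with [1 < a]: this is
    why stable laws of index larger than [1] have a finite first moment. *)
Lemma stable_kernel_mass_lty a k : 1 < a -> (stable_kernel_mass a k < +oo)%E.
Proof.
move=> a1; apply: (@integral_inv2_lty _ _ (2 + `|k|) a) => //.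
- by apply: measurable_funB => //; exact: measurable_stable_re.
- by move=> x; rewrite subr_ge0 stable_re_le1.
- move=> x _; rewrite (@le_trans _ _ 2) ?lerDl//.
  rewrite /stable_re; have := cos_geN1 (k * x `^ a).
  have : expR (- x `^ a) <= 1 by rewrite expR_le1 oppr_le0 powR_ge0.
  have := expR_ge0 (- x `^ a); nra.
- move=> x /andP[x0 x1].
  have xa := powR_ge0 x a.
  have e1 : expR (- x `^ a) <= 1 by rewrite expR_le1 oppr_le0 powR_ge0.
  have e0 := expR_ge0 (- x `^ a).
  have e2 := one_sub_expRN_le (x `^ a).
  have c1 := one_sub_cos_le_norm (k * x `^ a).
  rewrite normrM (ger0_norm xa) in c1.
  have c0 := one_sub_cos_ge0 (k * x `^ a).
  have -> : 1 - stable_re a k x = (1 - expR (- x `^ a)) +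
      expR (- x `^ a) * (1 - cos (k * x `^ a)) by rewrite /stable_re; ring.
  have : expR (- x `^ a) * (1 - cos (k * x `^ a)) <= `|k| * x `^ a.
    by rewrite (le_trans _ c1)// ler_piMl.
  nra.
Qed.

End stable_transform.

Section stable_absolute_moment.
Local Open Scope ereal_scope.
Context d (T : measurableType d) (R : realType) (P : probability T R).
Notation mu := (@lebesgue_measure R).
Notation D := (`]0%R, +oo[%classic : set R).

Lemma bounded_integrable (f : T -> R) (M : R) : measurable_fun setT f ->
  (forall w, `|f w| <= M)%R -> P.-integrable setT (EFin \o f).
Proof.
move=> mf fM; apply: (@le_integrable _ _ _ P _ _ _ (cst M%:E)) => //.
- exact/measurable_EFinP.
- move=> w _ /=; rewrite lee_fin (le_trans (fM w))// ler_norm//.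
- exact: finite_measure_integrable_cst.
Qed.

Definition has_stable_transform (a k l : R) (X : T -> R) := forall x : R, (0 <= x)%R ->
  \int[P]_w (cos (x * X w))%:E = (stable_re a k (l * x))%:E /\
  \int[P]_w (sin (x * X w))%:E = (stable_im a k (l * x))%:E.

Variables (a k l : R) (X : T -> R).
Hypotheses (a1 : (1 < a)%R) (l0 : (0 < l)%R).
Hypotheses (mX : measurable_fun setT X) (XE : has_stable_transform a k l X).

Definition abs_moment_const : R := fine (stable_kernel_mass a k) / fine cos_kernel_mass.

Let cos_kernel_mass_fin : (@cos_kernel_mass R) \is a fin_num.
Proof. by rewrite ge0_fin_numE ?cos_kernel_mass_lty// ltW// cos_kernel_mass_gt0. Qed.

Let stable_kernel_mass_fin : stable_kernel_mass a k \is a fin_num.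
Proof.
rewrite ge0_fin_numE ?stable_kernel_mass_lty//; apply: integral_ge0 => x _.
by rewrite lee_fin mulr_ge0 ?powR_ge0 ?subr_ge0 ?stable_re_le1.
Qed.

Lemma integral_one_sub_cos (x : R) :
  \int[mu]_(y in D) ((1 - cos (y * x)) * y `^ (-2))%:E = (`|x|)%:E * cos_kernel_mass.
Proof.
have [->|x0] := eqVneq x 0%R.
  rewrite normr0 mul0e; apply: integral0_eq => y _.
  by rewrite mulr0 cos0 subrr mul0r.
rewrite -(@integral_inv2_scale _ (fun y => 1 - cos y)%R) ?normr_gt0//.
- apply: eq_integral => y; rewrite inE/= in_itv/= andbT => y0.
  congr (EFin ((1 - _) * _)%R).
  by rewrite -{2}(gtr0_norm y0) -normrM cos_norm mulrC.
- apply: measurable_funB => //; exact: measurable_cos_comp.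
Qed.

(** Integrating [(1 - cos (y X)) * y `^ (-2)] over [y] first gives a multiple of
    [E |X|]; integrating over the probability space first gives a quantity that
    depends on [X] through its transform only, and scales like [l]. *)
Lemma stable_abs_moment : \int[P]_w (`|X w|)%:E = (abs_moment_const * l)%:E.
Proof.
pose f (z : T * R) : \bar R := ((1 - cos (z.2 * X z.1)) * z.2 `^ (-2))%:E.
have mf : measurable_fun setT f.
  apply/measurable_EFinP; apply: measurable_funM.
    apply: measurable_funB => //; apply: measurable_cos_comp.
    by apply: measurable_funM => //; exact: measurableT_comp.
  exact: measurable_powR_comp.
have f0 x y : 0 <= f (x, y).
  by rewrite lee_fin mulr_ge0 ?powR_ge0 ?one_sub_cos_ge0.
have := @fubini_tonelli_setX _ _ _ _ R P mu setT D f measurableT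
  (measurable_itv _) mf (fun x y _ _ => f0 x y).
under eq_integral do rewrite /f/= integral_one_sub_cos.
rewrite ge0_integralZr//; last 2 first.
  by apply/measurable_EFinP; exact: measurableT_comp.
  by rewrite ltW// cos_kernel_mass_gt0.
have -> : \int[mu]_(y in D) \int[P]_x f (x, y) = l%:E * stable_kernel_mass a k.
  rewrite -integral_inv2_scale//; last 2 first.
    by apply: measurable_funB => //; exact: measurable_stable_re.
    by move=> x; rewrite subr_ge0 stable_re_le1.
  apply: eq_integral => y; rewrite inE/= in_itv/= andbT => y0.
  have mc : measurable_fun setT (fun w => cos (y * X w)).
    by apply: measurable_cos_comp; exact: measurable_funM.
  have [cE _] := XE (ltW y0).
  rewrite /f/=; under eq_integral do rewrite EFinM.
  rewrite ge0_integralZr//; last 2 first.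
  - by apply/measurable_EFinP; exact: measurable_funB.
  - by rewrite lee_fin powR_ge0.
  rewrite integralB_EFin//; last 2 first.
  - exact: finite_measure_integrable_cst.
  - exact: (bounded_integrable mc (fun w => cos_max _)).
  rewrite cE integral_cst//= probability_setT mul1e -EFinB -EFinM//.
rewrite -(fineK cos_kernel_mass_fin) -(fineK stable_kernel_mass_fin) => E.
have nc0 : (0 < fine (@cos_kernel_mass R))%R by rewrite fine_gt0// cos_kernel_mass_gt0 cos_kernel_mass_lty.
move: (congr1 (fun z => z * (fine cos_kernel_mass)^-1%:E) E).
rewrite -muleA -EFinM mulfV ?gt_eqF// mule1 => ->.
by rewrite -!EFinM; congr EFin; rewrite /abs_moment_const; ring.
Qed.

End stable_absolute_moment.

(** * Limits along the integers *)

Section real_dominated_convergence.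
Context d (T : measurableType d) (R : realType).
Variables (m : {measure set T -> \bar R}) (D : set T).
Hypothesis mD : measurable D.

Lemma dominated_cvg_EFin (f_ : nat -> T -> R) (f g : T -> R) :
  (forall n, measurable_fun D (f_ n)) -> measurable_fun D f ->
  (forall x, D x -> f_ n x @[n --> \oo] --> f x) ->
  m.-integrable D (EFin \o g) ->
  (forall n x, D x -> `|f_ n x| <= g x) ->
  (\int[m]_(x in D) (f_ n x)%:E @[n --> \oo] --> \int[m]_(x in D) (f x)%:E)%E.
Proof.
move=> mf_ mf cvf ig fg.
have [] := @dominated_convergence _ _ _ m D mD (fun n x => (f_ n x)%:E)
  (EFin \o f) (EFin \o g).
- by move=> n; exact/measurable_EFinP.
- exact/measurable_EFinP.
- apply: aeW => x Dx; apply/cvg_EFin; first exact: nearW.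
  exact: cvf.
- exact: ig.
- by apply: aeW => x n Dx; rewrite lee_fin fg.
- by [].
Qed.

End real_dominated_convergence.

Section power_decay.
Context {R : realType}.

Lemma cvg_invS0 : (n.+1%:R^-1 : R) @[n --> \oo] --> (0 : R).
Proof. exact: cvg_harmonic. Qed.

Lemma cvg_invS0_right : (n.+1%:R^-1 : R) @[n --> \oo] --> (0 : R)^'+.
Proof.
move=> A [e /= e0 eA].
have := @cvg_invS0; move=> /cvgrPdist_lt /(_ _ e0) [N _ NA].
exists N => //= n Nn; apply: eA => /=; first exact: NA.
by rewrite invr_gt0.
Qed.

Lemma cvg_natS_powRN (p : R) : 0 < p ->
  (n.+1%:R^-1 `^ p : R) @[n --> \oo] --> (0 : R).
Proof.
move=> p0; apply: (@cvg_comp _ _ _ (fun n => n.+1%:R^-1 : R) (fun x => x `^ p) _ (0^'+)).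
  exact: cvg_invS0_right.
exact: powR_cvg0.
Qed.

Lemma cvg_natSM (x : R) : 0 < x -> (n.+1%:R * x) @[n --> \oo] --> +oo.
Proof.
move=> x0; apply/cvgryPge => M; near=> n.
rewrite -ler_pdivrMr// (@le_trans _ _ n%:R) ?ler_nat//.
by near: n; exact: nbhs_infty_ger.
Unshelve. all: by end_near. Qed.

(** Smooth approximation of the sign function. *)
Lemma cvg_atan_natSM (x : R) :
  atan (n.+1%:R * x) @[n --> \oo] --> pi / 2 * Num.sg x.
Proof.
have pos y : 0 < y -> atan (n.+1%:R * y) @[n --> \oo] --> (pi / 2 : R).
  move=> y0; apply: (@cvg_comp _ _ _ (fun n => n.+1%:R * y) atan _ +oo%R).
    exact: cvg_natSM.
  exact: cvgy_atan.
have [x0|x0|->] := ltgtP x 0.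
- rewrite ltr0_sg// mulrN1.
  rewrite (_ : (fun n => _) = (fun n => - atan (n.+1%:R * (- x)))).
    by apply: cvgN; apply: pos; rewrite oppr_gt0.
  by apply/funext => n; rewrite mulrN atanN opprK.
- by rewrite gtr0_sg// mulr1; exact: pos.
- rewrite sgr0 mulr0; under eq_fun do rewrite mulr0 atan0; exact: cvg_cst.
Qed.

End power_decay.

(** * Mean, atom at the origin and sign of a stable variable *)

Section stable_mean_and_sign.
Local Open Scope ereal_scope.
Context d (T : measurableType d) (R : realType) (P : probability T R).
Notation mu := (@lebesgue_measure R).
Notation D := (`]0%R, +oo[%classic : set R).
Variables (a k l : R) (X : T -> R).
Hypotheses (a1 : (1 < a)%R) (l0 : (0 < l)%R).
Hypotheses (mX : measurable_fun setT X) (XE : has_stable_transform P a k l X).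

Lemma stable_integrable : P.-integrable setT (EFin \o X).
Proof.
apply/integrableP; split; first exact/measurable_EFinP.
by rewrite (stable_abs_moment a1 l0 mX XE) ltry.
Qed.

Lemma norm_stable_im_le (x : R) : (`|stable_im a k x| <= `|k| * x `^ a)%R.
Proof.
rewrite /stable_im normrM (ger0_norm (expR_ge0 _)).
rewrite (@le_trans _ _ (1 * `|k * x `^ a|)%R)//.
  by rewrite ler_pM ?expR_ge0 ?norm_sin_le// expR_le1 oppr_le0 powR_ge0.
by rewrite mul1r normrM (ger0_norm (powR_ge0 _ _)).
Qed.

(** The imaginary part of the transform is of order [x `^ a] at [0], hence
    [E (n * sin (X / n))] vanishes in the limit; dominated convergence by [|X|]
    identifies this limit with [E X]. *)
Lemma stable_mean0 : \int[P]_w (X w)%:E = 0.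
Proof.
pose f n (w : T) : R := (n.+1%:R * sin (n.+1%:R^-1 * X w))%R.
have mf n : measurable_fun setT (f n).
  apply: measurable_funM => //.
  by apply: measurable_sin_comp; exact: measurable_funM.
have cv : \int[P]_w (f n w)%:E @[n --> \oo] --> \int[P]_w (X w)%:E.
  apply: (dominated_cvg_EFin measurableT mf mX _ (integrable_norm stable_integrable)).
    move=> w _; apply/subr_cvg0.
    apply/norm_cvg0P.
    apply: (@squeeze_cvgr _ _ _ _ (cst 0%R) (fun n => X w ^+ 2 * n.+1%:R^-1)%R).
    - apply: nearW => n; rewrite normr_ge0/= /f.
      have n0 : (n.+1%:R : R) != 0%R by [].
      rewrite (_ : _ - _ = - (n.+1%:R * (n.+1%:R^-1 * X w - sin (n.+1%:R^-1 * X w))))%R; last first.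
        by rewrite mulrBr mulVKf// opprB.
      rewrite normrN normrM ger0_norm//.
      rewrite (le_trans (ler_wpM2l _ (sin_sub_id_le _)))//.
      by rewrite le_eqVlt; apply/orP; left; apply/eqP; field.
    - exact: cvg_cst.
    - rewrite -[X in _ --> X](mulr0 (X w ^+ 2)%R); apply: cvgM; first exact: cvg_cst.
      exact: cvg_invS0.
  move=> n w _ /=; rewrite /f normrM ger0_norm//.
  by rewrite -ler_pdivlMl// (le_trans (norm_sin_le _))// normrM ger0_norm.
have cv0 : \int[P]_w (f n w)%:E @[n --> \oo] --> 0.
  have fE n : \int[P]_w (f n w)%:E =
      (n.+1%:R * stable_im a k (l * n.+1%:R^-1))%:E.
    have n0 : (0 <= n.+1%:R^-1 :> R)%R by [].
    have [_ sE] := XE n0.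
    rewrite EFinM -sE -integralZl//.
    by apply: (@bounded_integrable _ _ _ P _ 1%R); [
      apply: measurable_sin_comp; exact: measurable_funM|move=> w; exact: sin_max].
  under eq_fun do rewrite fE.
  apply/cvg_EFin; first exact: nearW.
  apply/norm_cvg0P.
  apply: (@squeeze_cvgr _ _ _ _ (cst 0%R)
    (fun n => (`|k| * l `^ a) * n.+1%:R^-1 `^ (a - 1))%R).
  - apply: nearW => n; rewrite normr_ge0/= normrM ger0_norm//.
    rewrite (le_trans (ler_wpM2l _ (norm_stable_im_le _)))//.
    rewrite powRM ?(ltW l0)// -(mulr_powRB1 (x := n.+1%:R^-1)) ?(lt_trans ltr01)//.
    have n0 : (n.+1%:R : R) != 0%R by [].
    by rewrite le_eqVlt; apply/orP; left; apply/eqP; field.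
  - exact: cvg_cst.
  - rewrite -[X in _ --> X](mulr0 (`|k| * l `^ a)%R); apply: cvgM; first exact: cvg_cst.
    by apply: cvg_natS_powRN; rewrite subr_gt0.
by rewrite -(cvg_lim _ cv)// (cvg_lim _ cv0).
Qed.

Lemma stable_pos_part_moment :
  \int[P]_w (Num.max (X w) 0)%:E = (abs_moment_const a k / 2 * l)%:E.
Proof.
transitivity (\int[P]_w (2^-1%:E * ((`|X w|)%:E + (X w)%:E))).
  apply: eq_integral => w _; rewrite -EFinD -EFinM; congr EFin.
  by have [x0|x0] := leP (X w) 0%R; [rewrite ler0_norm//|rewrite gtr0_norm//]; lra.
have iX := stable_integrable.
rewrite integralZl//; last first.
  by apply: integrableD => //; exact: (integrable_norm iX).
rewrite integralD//; last exact: (integrable_norm iX).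
rewrite (stable_abs_moment a1 l0 mX XE) stable_mean0 adde0 -EFinM; congr EFin.
by ring.
Qed.

(** A Laplace transform in [y] commutes with the expectation, provided the
    integrand has a bound that is uniform in [y] and integrable over the
    probability space. *)
Lemma laplace_fubini (h : T * R -> R) (B : T -> R) (H : R -> R) (c : R) :
  (0 < c)%R -> measurable_fun setT h -> P.-integrable setT (EFin \o B) ->
  (forall w y, (0 < y)%R -> (`|h (w, y)| <= B w)%R) ->
  (forall y, (0 < y)%R -> \int[P]_w (h (w, y))%:E = (H y)%:E) ->
  \int[P]_w \int[mu]_(y in D) (expR (- (c * y)) * h (w, y))%:E =
  \int[mu]_(y in D) (expR (- (c * y)) * H y)%:E.
Proof.
move=> c0 mh iB hB hH.
pose f (z : T * R) : \bar R := (expR (- (c * z.2)) * h z)%:E.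
have mf : measurable_fun setT f.
  apply/measurable_EFinP; apply: measurable_funM => //.
  by apply: measurable_expR_comp; apply: measurable_funN; exact: measurable_funM.
have iE := integral_laplace c0.
have B0 w : (0 <= B w)%R by exact: le_trans (normr_ge0 _) (hB w 1%R ltr01).
have foo : \int[P]_(w in setT) \int[mu]_(y in D) `|f (w, y)| < +oo.
  apply: (@le_lt_trans _ _ (\int[P]_w ((B w)%:E * (c^-1)%:E))).
    apply: ge0_le_integral => //.
    - by move=> w _; exact: integral_ge0.
    - exact: measurable_fun_integral_abs.
    - by apply: emeasurable_funM => //; exact: measurable_int iB.
    - move=> w _; rewrite -iE -ge0_integralZl//; last 2 first.
      + apply/measurable_EFinP; apply: measurable_expR_comp.
        by apply: measurable_funN; exact: measurable_funM.
      + by rewrite lee_fin.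
      apply: ge0_le_integral => //.
      + apply: measurableT_comp => //; apply: measurable_funTS.
        exact: measurableT_comp.
      + apply: measurable_funeM; apply/measurable_EFinP.
        by apply: measurable_expR_comp; apply: measurable_funN; exact: measurable_funM.
      + move=> y /=; rewrite in_itv/= andbT => y0.
        rewrite lee_fin normrM ger0_norm ?expR_ge0// mulrC.
        by rewrite ler_wpM2r ?expR_ge0// hB.
  rewrite ge0_integralZr//.
  - rewrite lte_mul_pinfty ?integral_ge0//.
      by move=> w _; rewrite lee_fin.
      exact: integrable_fin_num iB.
      by rewrite ltry.
  - exact: measurable_int iB.
  - by move=> w _; rewrite lee_fin.
  - by rewrite lee_fin invr_ge0 ltW.
rewrite (@Fubini_setX _ _ _ _ R P mu setT D f measurableT (measurable_itv _) mf foo).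
apply: eq_integral => y; rewrite inE/= in_itv/= andbT => y0.
rewrite /f/= EFinM -hH// -integralZl//.
apply: (le_integrable _ _ _ iB) => //.
  by apply/measurable_EFinP; exact: measurableT_comp.
by move=> w _ /=; rewrite lee_fin (le_trans (hB w y y0))// ler_norm.
Qed.

Lemma stable_re_cvgy : stable_re a k x @[x --> +oo%R] --> (0 : R)%R.
Proof.
apply/norm_cvg0P.
apply: (@squeeze_cvgr _ _ _ _ (cst 0%R) (fun x => expR (- x `^ a))).
- apply: nearW => x; rewrite normr_ge0/= /stable_re normrM ger0_norm ?expR_ge0//.
  by rewrite ler_piMr ?expR_ge0 ?cos_max.
- exact: cvg_cst.
- apply: (@cvg_comp _ _ _ (fun x : R => x `^ a)%R (fun x => expR (- x)) _ +oo%R).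
    by apply: powR_cvgy; exact: ltW.
  exact: cvgr_expR.
Qed.

(** [(1 + (n X) ^+ 2)^-1] is [1] where [X = 0], and its expectation is the
    integral of [expR (- y)] times the real part of the transform at [n y],
    which decays as [n] grows. *)
Lemma stable_no_atom0 : P [set w | X w = 0%R] = 0.
Proof.
have mA : measurable [set w | X w = 0%R].
  by have := mX measurableT (measurable_set1 0%R); rewrite setTI.
pose F n (y : R) := (expR (- (1 * y)) * stable_re a k (l * (n.+1%:R * y)))%R.
have PF n : P [set w | X w = 0%R] <= \int[mu]_(y in D) (F n y)%:E.
  rewrite -(@laplace_fubini (fun z => cos (n.+1%:R * z.2 * X z.1)) (cst 1%R))//; last first.
  - move=> y y0; have y1 : (0 <= n.+1%:R * y)%R by rewrite mulr_ge0// ltW.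
    by have [cE _] := XE y1.
  - by move=> w y _; exact: cos_max.
  - exact: finite_measure_integrable_cst.
  - apply: measurable_cos_comp; apply: measurable_funM; last exact: measurableT_comp.
    exact: measurable_funM.
  rewrite -[X in P X]setIT -integral_indic//.
  have cE w : \int[mu]_(y in D) (expR (- (1 * y)) * cos (n.+1%:R * y * X w))%:E =
      ((1 + (n.+1%:R * X w) ^+ 2)^-1)%:E.
    under eq_integral do rewrite mulrAC.
    by rewrite integral_laplace_cos// expr1n div1r.
  under [leRHS]eq_integral do rewrite cE.
  apply: ge0_le_integral => //.
  - by apply/measurable_EFinP; exact: measurable_indic.
  - apply/measurable_EFinP; apply: measurable_invr_comp.
      by move=> w; rewrite addr_ge0// sqr_ge0.
    apply: measurable_funD => //; apply: measurable_funX.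
    exact: measurable_funM.
  - move=> w _; rewrite lee_fin indicE; case: (boolP (w \in _)) => [|_].
      by rewrite inE/= => ->; rewrite mulr0 expr0n addr0 invr1.
    by rewrite invr_ge0 addr_ge0// sqr_ge0.
have F0 : \int[mu]_(y in D) (F n y)%:E @[n --> \oo] --> \int[mu]_(y in D) (cst 0%R y)%:E.
  apply: (@dominated_cvg_EFin _ _ _ mu D _ F _ (fun y => expR (- (1 * y)))) => //.
  - move=> n; apply: measurable_funM.
      by apply: measurable_expR_comp; apply: measurable_funN; exact: measurable_funM.
    apply: measurable_funTS; apply: measurableT_comp; first exact: measurable_stable_re.
    by apply: measurable_funM => //; exact: measurable_funM.
  - move=> y /=; rewrite in_itv/= andbT => y0.
    rewrite -[X in _ --> X](mulr0 (expR (- (1 * y)))); apply: cvgM; first exact: cvg_cst.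
    apply: (@cvg_comp _ _ _ (fun n => l * (n.+1%:R * y))%R (stable_re a k) _ +oo%R); last exact: stable_re_cvgy.
    under eq_fun do rewrite mulrCA.
    by apply: cvg_natSM; rewrite mulr_gt0.
  - exact: integrable_laplace.
  - move=> n y _; rewrite /F normrM ger0_norm ?expR_ge0// ler_piMr ?expR_ge0//.
    rewrite /stable_re normrM ger0_norm ?expR_ge0//.
    by rewrite mulr_ile1 ?expR_ge0 ?cos_max// expR_le1 oppr_le0 powR_ge0.
apply/eqP; rewrite eq_le measure_ge0 andbT.
rewrite (_ : \int[mu]_(y in D) (cst 0%R y)%:E = 0) in F0; last exact: integral0.
apply: (cvge_ge _ F0) => //; exact: nearW.
Qed.

Lemma stable_sg_integrable : P.-integrable setT (fun w => (Num.sg (X w))%:E).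
Proof.
apply: (@bounded_integrable _ _ _ P _ 1%R); first exact: measurable_sg_comp.
by move=> w; rewrite normr_sg lern1 leq_b1.
Qed.

(** The expectation of [atan (n X)] is the integral of the imaginary part of the
    transform against [expR (- y / n) / y].  The left-hand side tends to
    [pi / 2] times the expected sign; the right-hand side tends to an integral
    of the same shape as the regularizing ones, with exponent [a] instead of
    [1], whence the factor [a^-1]. *)
Lemma stable_sgn_moment :
  \int[P]_w (Num.sg (X w))%:E = (2 / pi * (atan k / a))%:E.
Proof.
have a0 : (0 < a)%R by exact: lt_trans a1.
have la0 : (0 < l `^ a)%R by rewrite powR_gt0.
pose H (y : R) : R := (stable_im a k (l * y) * y `^ (-1))%R.
pose G n (y : R) := (expR (- (n.+1%:R^-1 * y)) * H y)%R.
have HE y : D y -> H y =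
    (expR (- (l `^ a * y `^ a)) * (sin (k * l `^ a * y `^ a) * y `^ (-1)))%R.
  rewrite /= in_itv/= andbT => y0.
  by rewrite /H /stable_im powRM ?ltW// !mulrA.
have iH : mu.-integrable D (EFin \o H).
  apply: eq_integrable (integrable_expR_sinc (ltW a1) la0 (k * l `^ a)) => // y.
  by rewrite inE => yD; rewrite /= HE.
have GE n : \int[P]_w (atan (n.+1%:R * X w))%:E = \int[mu]_(y in D) (G n y)%:E.
  rewrite -(@laplace_fubini (fun z => (sin (z.2 * X z.1) * z.2 `^ (-1))%R) (fun w => `|X w|)%R)//; last first.
  - move=> y y0; have [_ sE] := XE (ltW y0).
    rewrite /H EFinM -sE -integralZr//.
    apply: (@bounded_integrable _ _ _ P _ 1%R); last by move=> w; exact: sin_max.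
    by apply: measurable_sin_comp; exact: measurable_funM.
  - move=> w y y0 /=; rewrite powR_inv1 ?(ltW y0)// normrM normfV (gtr0_norm y0).
    by rewrite ler_pdivrMr// (le_trans (norm_sin_le _))// normrM (gtr0_norm y0) mulrC.
  - exact: integrable_norm stable_integrable.
  - apply: measurable_funM; last exact: measurable_powR_comp.
    apply: measurable_sin_comp; apply: measurable_funM => //; exact: measurableT_comp.
  apply: eq_integral => w _ /=.
  under eq_integral do rewrite (mulrC _ (X w)).
  by rewrite integral_laplace_sinc// invrK mulrC.
have cvG : \int[mu]_(y in D) (G n y)%:E @[n --> \oo] --> \int[mu]_(y in D) (H y)%:E.
  have mH : measurable_fun D H by apply/measurable_EFinP; exact: measurable_int iH.
  apply: (@dominated_cvg_EFin _ _ _ mu D _ G _ (fun y => `|H y|)%R) => //.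
  - move=> n; apply: measurable_funM => //.
    by apply: measurable_expR_comp; apply: measurable_funN; exact: measurable_funM.
  - move=> y _; rewrite -[X in _ --> X]mul1r; apply: cvgM; last exact: cvg_cst.
    rewrite -[X in _ --> X]expR0; apply: (@cvg_comp _ _ _ (fun n => - (n.+1%:R^-1 * y))%R expR); last exact: continuous_expR.
    rewrite -oppr0; apply: cvgN; rewrite -(mul0r y); apply: cvgM; last exact: cvg_cst.
    exact: cvg_invS0.
  - exact: integrable_norm iH.
  - move=> n y /=; rewrite in_itv/= andbT => y0.
    rewrite /G normrM ger0_norm ?expR_ge0// ler_piMl// expR_le1 oppr_le0.
    by rewrite mulr_ge0// ltW.
have cvA : \int[P]_w (atan (n.+1%:R * X w))%:E @[n --> \oo] -->
    \int[P]_w (pi / 2 * Num.sg (X w))%:E.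
  apply: (@dominated_cvg_EFin _ _ _ P setT _ _ _ (cst (pi / 2)%R)) => //.
  - by move=> n; apply: measurable_atan_comp; exact: measurable_funM.
  - by apply: measurable_funM => //; exact: measurable_sg_comp.
  - by move=> w _; exact: cvg_atan_natSM.
  - exact: finite_measure_integrable_cst.
  - move=> n w _ /=; rewrite ler_norml.
    by rewrite ltW ?atan_gtNpi2//= ltW// atan_ltpi2.
have E : \int[P]_w (pi / 2 * Num.sg (X w))%:E = (atan k / a)%:E.
  rewrite -(cvg_lim _ cvA)//; under eq_fun do rewrite GE.
  rewrite (cvg_lim _ cvG)//.
  transitivity (\int[mu]_(y in D) (expR (- (l `^ a * y `^ a)) * (sin (k * l `^ a * y `^ a) * y `^ (-1)))%:E).
    by apply: eq_integral => y; rewrite inE => /HE ->.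
  by rewrite integral_expR_sinc ?ltW// mulfK ?gt_eqF.
have isg := stable_sg_integrable.
have {}E : \int[P]_w ((pi / 2)%:E * (Num.sg (X w))%:E) = (atan k / a)%:E := E.
rewrite integralZl// in E.
transitivity ((2 / pi)%:E * ((pi / 2)%:E * \int[P]_w (Num.sg (X w))%:E)); last first.
  by rewrite E -EFinM.
have pi2 : (2 / pi * (pi / 2) = 1 :> R)%R.
  by rewrite mulrA divfK ?lt0r_neq0 ?pi_gt0// divff.
by rewrite muleA -EFinM pi2 mul1e.
Qed.

Lemma stable_positivity : atan k = (pi - pi * a / 2)%R ->
  P [set w | (0 < X w)%R] = (a^-1)%:E.
Proof.
move=> kE.
have mp : measurable [set w | (0 < X w)%R].
  have -> : [set w | (0 < X w)%R] = X @^-1` `]0%R, +oo[.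
    by apply/seteqP; split => w /=; rewrite in_itv/= andbT.
  by rewrite -[X in measurable X]setTI; exact: mX measurableT _ (measurable_itv _).
have mA : measurable [set w | X w = 0%R].
  by have := mX measurableT (measurable_set1 0%R); rewrite setTI.
have i1 (A : set T) : measurable A -> P.-integrable setT (fun w => (\1_A w)%:E).
  by move=> mA'; exact: integrable_indic.
rewrite -[X in P X]setIT -integral_indic//.
transitivity (\int[P]_w (2^-1%:E * ((Num.sg (X w))%:E +
    (1 - \1_[set w | X w = 0%R] w)%:E))).
  apply: eq_integral => w _; rewrite -EFinD -EFinM; congr EFin.
  rewrite !indicE; have [x0|x0|x0] := ltgtP (X w) 0%R.
  - rewrite memNset/=; last by apply/negP; rewrite -leNgt ltW.
    rewrite memNset/=; last by move=> x00; rewrite x00 ltxx in x0.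
    by rewrite ltr0_sg//; ring.
  - rewrite mem_set//= memNset/=; last by move=> x00; rewrite x00 ltxx in x0.
    by rewrite gtr0_sg//; field.
  - rewrite memNset/=; last by rewrite x0 ltxx.
    by rewrite mem_set//= x0 sgr0; ring.
have isg := stable_sg_integrable.
have i2 : P.-integrable setT (fun w => (1 - \1_[set w | X w = 0%R] w)%:E).
  apply: (@bounded_integrable _ _ _ P _ 1%R) => [|w].
    by apply: measurable_funB => //; exact: measurable_indic.
  by rewrite indicE; case: (w \in _); rewrite ?subrr ?normr0 ?subr0 ?normr1.
rewrite integralZl//; last exact: integrableD.
rewrite integralD// stable_sgn_moment integralB_EFin//; last 2 first.
- exact: finite_measure_integrable_cst.
- exact: i1.
rewrite integral_cst//= probability_setT mule1 integral_indic// setIT.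
rewrite [X in 1 - X](_ : _ = 0)%E; last exact: stable_no_atom0.
rewrite sube0 -EFinD -EFinM kE; congr EFin.
have a0 : (0 < a)%R by exact: lt_trans a1.
by move: (@pi R) (pi_gt0 R) => p p0; field; rewrite !lt0r_neq0.
Qed.

End stable_mean_and_sign.

(** * Maximum of partial sums under cyclic shifts *)

Section partial_sum_maximum.
Context {R : realType}.
Implicit Types (x y : nat -> R) (n k c : nat).

Definition psum x n : R := \sum_(i < n) x i.

(** The maximum of the partial sums of order at most [n], the empty one
    included. *)
Fixpoint walkmax x n : R :=
  if n is m.+1 then Num.max (walkmax x m) (psum x m.+1) else 0.

Lemma psum0 x : psum x 0 = 0.
Proof. by rewrite /psum big_ord0. Qed.

Lemma psumS x n : psum x n.+1 = psum x n + x n.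
Proof. by rewrite /psum big_ord_recr. Qed.

Lemma psum_recl x n : psum x n.+1 = x 0%N + psum (fun i => x i.+1) n.
Proof. by rewrite /psum big_ord_recl; congr (_ + _); apply: eq_bigr. Qed.

Lemma eq_psum x y n : (forall i, (i < n)%N -> x i = y i) -> psum x n = psum y n.
Proof. by move=> xy; apply: eq_bigr => i _; exact: xy. Qed.

Lemma eq_walkmax x y n : (forall i, (i < n)%N -> x i = y i) ->
  walkmax x n = walkmax y n.
Proof.
elim: n => [//|n IH] xy /=; rewrite IH; first by rewrite (eq_psum xy).
by move=> i ni; apply: xy; exact: ltnW.
Qed.

Lemma walkmax_ge0 x n : 0 <= walkmax x n.
Proof. by elim: n => [//|n IH] /=; rewrite le_max IH. Qed.

Lemma psum_le_walkmax x n k : (k <= n)%N -> psum x k <= walkmax x n.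
Proof.
elim: n => [|n IH]; first by rewrite leqn0 => /eqP ->; rewrite psum0.
rewrite leq_eqVlt => /predU1P[->|kn] /=; first by rewrite le_max lexx orbT.
by rewrite le_max IH.
Qed.

Lemma walkmax_attained x n : exists2 k, (k <= n)%N & walkmax x n = psum x k.
Proof.
elim: n => [|n [k kn kE]] /=; first by exists 0%N; rewrite ?psum0.
have [h|h] := leP (walkmax x n) (psum x n.+1); first by exists n.+1.
by exists k; rewrite ?kE// ltnW.
Qed.

(** Removing the first step shifts all nonempty partial sums by it. *)
Lemma walkmax_recl x n :
  walkmax x n.+1 = Num.max 0 (x 0%N + walkmax (fun i => x i.+1) n).
Proof.
elim: n => [|n IH].
  by rewrite /= addr0 psumS psum0 add0r.
rewrite [LHS]/= -/(walkmax x n.+1) IH psum_recl -maxA; congr (Num.max _ _).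
by rewrite /= -addr_maxr.
Qed.

Lemma psum_shift_period x n c : (forall i, x (i + n)%N = x i) ->
  psum (fun i => x (c + i)%N) n = psum x n.
Proof.
move=> xn; elim: c => [|c IH]; first by apply: eq_psum.
rewrite -[RHS]IH.
have := psumS (fun i => x (c + i)%N) n.
rewrite psum_recl addn0 xn addrC => /addIr <-.
by apply: eq_psum => i _; rewrite addSnnS.
Qed.

(** Combinatorial core of Spitzer's identity, for a periodic sequence with sum
    [S] over a period.  If [S <= 0] the last partial sum never improves the
    maximum.  If [0 < S] the full maximum is never attained by the empty sum, so
    it is the first step plus the shorter maximum of the next cyclic shift; the
    differences telescope around the cycle and leave [S]. *)
Lemma sum_cyclic_walkmax x n : (forall i, x (i + n.+1)%N = x i) ->
  \sum_(c < n.+1) walkmax (fun i => x (c + i)%N) n.+1 =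
  Num.max (psum x n.+1) 0 + \sum_(c < n.+1) walkmax (fun i => x (c + i)%N) n.
Proof.
move=> xn; set S := psum x n.+1.
pose W c := walkmax (fun i => x (c + i)%N) n.
have [S0|S0] := leP S 0.
  rewrite add0r; apply: eq_bigr => c _ /=.
  apply/max_idPl; rewrite psum_shift_period//.
  exact: le_trans S0 (walkmax_ge0 _ _).
transitivity (\sum_(c < n.+1) (x c + (W c.+1 - W c) + W c)).
  apply: eq_bigr => c _; rewrite -addrA subrK walkmax_recl addn0.
  have -> : walkmax (fun i => x (c + i.+1)%N) n = W c.+1.
    by apply: eq_walkmax => i _; rewrite addSnnS.
  apply/max_idPr; apply: (le_trans (ltW S0)).
  rewrite /S -(psum_shift_period c xn) psum_recl addn0 lerD2l.
  rewrite (_ : psum _ n = psum (fun i => x (c.+1 + i)%N) n); first exact: psum_le_walkmax.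
  by apply: eq_psum => i _; rewrite addSnnS.
rewrite big_split/= big_split/=; congr (_ + _).
rewrite -(big_mkord xpredT (fun c => W c.+1 - W c)) telescope_sumr//.
have -> : W n.+1 = W 0%N.
  by apply: eq_walkmax => i _; rewrite addnC xn.
by rewrite subrr addr0.
Qed.

End partial_sum_maximum.

(** * Laws of random vectors with independent coordinates *)

Section tuple_laws.
Context {R : realType} (n : nat).

Definition tuple_box (B : 'I_n -> set R) : set (n.-tuple R) :=
  [set v | forall i, B i (tnth v i)].

Definition tuple_boxes : set (set (n.-tuple R)) :=
  [set A | exists2 B : 'I_n -> set R, (forall i, measurable (B i)) & A = tuple_box B].

Lemma measurable_tuple_box (B : 'I_n -> set R) :
  (forall i, measurable (B i)) -> measurable (tuple_box B).
Proof.
move=> mB.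
rewrite (_ : tuple_box B = \bigcap_i ((fun v => tnth v i) @^-1` B i)); last first.
  by apply/seteqP; split => [v vB i _|v vB i]; [exact: vB|exact: (vB i I)].
apply: fin_bigcap_measurable => // i _.
by rewrite -[X in measurable X]setTI; exact: measurable_tnth.
Qed.

Lemma measurable_tuple_boxes : @measurable _ (n.-tuple R) = <<s tuple_boxes >>.
Proof.
apply/seteqP; split; last first.
  apply: smallest_sub; first exact: sigma_algebra_measurable.
  by move=> _ [B mB ->]; exact: measurable_tuple_box.
apply: smallest_sub; first exact: smallest_sigma_algebra.
move=> A; rewrite -bigcup_seq/= => -[i _ [B mB <-]].
apply: sub_sigma_algebra.
exists (fun j => if j == i then B else setT).
  by move=> j; case: ifP.
apply/seteqP; split => v /=.
  by move=> [_ Bv] j; case: eqP => [->|].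
by move=> /(_ i); rewrite eqxx.
Qed.

(** Boxes generate the product sigma-algebra and are closed under
    intersection. *)
Lemma tuple_measure_unique (m1 m2 : {measure set (n.-tuple R) -> \bar R}) :
  (m1 setT < +oo)%E ->
  (forall B : 'I_n -> set R, (forall i, measurable (B i)) ->
    m1 (tuple_box B) = m2 (tuple_box B)) ->
  forall A, measurable A -> m1 A = m2 A.
Proof.
move=> m1oo m12 A mA.
apply: (measure_unique tuple_boxes (fun=> setT)) => //.
- exact: measurable_tuple_boxes.
- move=> _ _ [B mB ->] [C mC ->]; exists (fun i => B i `&` C i).
    by move=> i; exact: measurableI.
  apply/seteqP; split => v /=.
    by move=> [vB vC] i; split; [exact: vB|exact: vC].
  by move=> vBC; split => i; have [] := vBC i.
- move=> _; exists (fun=> setT) => //.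
  by apply/seteqP; split.
- by rewrite bigcup_const.
- by move=> _ [B mB ->]; exact: m12.
Qed.

End tuple_laws.

Section independent_vectors.
Context d (T : measurableType d) (R : realType) (P : probability T R).

Definition vec (X : nat -> T -> R) n (w : T) : n.-tuple R := [tuple X i w | i < n].

Lemma measurable_vec (X : nat -> T -> R) n :
  (forall i, measurable_fun setT (X i)) -> measurable_fun setT (vec X n).
Proof.
move=> mX; apply/measurable_fun_tnthP => i.
by rewrite (_ : _ \o _ = X i)//; apply/funext => w /=; rewrite tnth_mktuple.
Qed.

Lemma preimage_vec_box (X : nat -> T -> R) n (B : 'I_n -> set R) :
  vec X n @^-1` tuple_box B = [set w | forall i : 'I_n, B i (X i w)].
Proof.
by apply/seteqP; split => w /= wB i; have := wB i; rewrite /= tnth_mktuple.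
Qed.

(** Mutual independence speaks of boxes only; uniqueness of measures extends it
    to any event about the first [n] variables jointly. *)
Lemma independent_vec_last (X : nat -> {RV P >-> R}) n
    (A : set (n.-tuple R)) (B : set R) :
  mutually_independent (fun i : 'I_n.+1 => X i) ->
  measurable A -> measurable B ->
  P ((vec (fun i => X i) n @^-1` A) `&` (X n @^-1` B)) =
  (P (vec (fun i => X i) n @^-1` A) * P (X n @^-1` B))%E.
Proof.
move=> iX mA mB; set V := vec _ n.
have mV : measurable_fun setT V by exact: measurable_vec.
have mXB : measurable (X n @^-1` B).
  by rewrite -[X in measurable X]setTI; exact: measurable_funPT.
pose p : {nonneg R} := NngNum (fine_ge0 (measure_ge0 P (X n @^-1` B))).
have pE : P (X n @^-1` B) = p%:num%:E.
  by rewrite fineK// fin_num_measure.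
rewrite pE muleC.
apply: (@tuple_measure_unique _ _ (pushforward (mrestr P mXB) V)
  (mscale p (pushforward P V))) => //.
  apply: (@le_lt_trans _ _ 1%E); last exact: ltry.
  apply: probability_le1; apply: measurableI => //.
  by rewrite -[X in measurable X]setTI; exact: mV.
move=> C mC; rewrite /pushforward /mscale /mrestr -pE.
have key (B' : set R) : measurable B' ->
    P (V @^-1` tuple_box C `&` X n @^-1` B') =
    (\prod_(i < n) P (X i @^-1` C i) * P (X n @^-1` B'))%E.
  move=> mB'.
  pose C' (i : 'I_n.+1) : set R := if unlift ord_max i is Some j then C j else B'.
  have C'l (i : 'I_n) : C' (widen_ord (leqnSn n) i) = C i.
    rewrite /C' (_ : widen_ord _ _ = lift ord_max i) ?liftK//.
    by apply: val_inj; rewrite /= /bump leqNgt ltn_ord.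
  have C'm : C' ord_max = B' by rewrite /C' unlift_none.
  have mC' i : measurable (C' i) by rewrite /C'; case: unlift.
  transitivity (P [set w | forall i : 'I_n.+1, C' i (X i w)]).
    congr (P _); rewrite preimage_vec_box; apply/seteqP; split => w /=.
      move=> [wC wB] i; rewrite /C'; case: unliftP => [j|] ->.
        by have := wC j; rewrite lift_max.
      by [].
    move=> wC; split; last by have := wC ord_max; rewrite C'm.
    by move=> i; have := wC (widen_ord (leqnSn n) i); rewrite C'l.
  rewrite iX// big_ord_recr/= C'm; congr (_ * _)%E.
  by apply: eq_bigr => i _; rewrite C'l.
apply: etrans (key _ mB) _; rewrite muleC; congr (_ * _)%E.
  exact: pE.
have := key setT measurableT.
rewrite preimage_setT setIT probability_setT mule1 => h; exact: esym h.
Qed.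

(** The law of an independent and identically distributed family is invariant
    under permutations, by uniqueness of measures from boxes. *)
Lemma iid_reindex (X : nat -> {RV P >-> R}) n (s : 'I_n -> 'I_n)
    (F : n.-tuple R -> \bar R) :
  mutually_independent (fun i : 'I_n => X i) ->
  (forall i, same_distribution (X i) (X 0%N)) ->
  injective s -> measurable_fun setT F -> (forall v, 0 <= F v)%E ->
  (\int[P]_w F [tuple X (s i) w | i < n] = \int[P]_w F [tuple X i w | i < n])%E.
Proof.
move=> iX sX s_inj mF F0.
pose V w := [tuple (X i w : R) | i < n]; pose W w := [tuple (X (s i) w : R) | i < n].
have mV : measurable_fun setT V.
  apply/measurable_fun_tnthP => i.
  by rewrite (_ : _ \o _ = X i)//; apply/funext => w /=; rewrite tnth_mktuple.
have mW : measurable_fun setT W.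
  apply/measurable_fun_tnthP => i.
  by rewrite (_ : _ \o _ = X (s i))//; apply/funext => w /=; rewrite tnth_mktuple.
have VW A : measurable A -> pushforward P W A = pushforward P V A.
  apply: tuple_measure_unique => //.
    apply: (@le_lt_trans _ _ 1%E); last exact: ltry.
    by apply: probability_le1; rewrite -[X in measurable X]setTI; exact: mW.
  move=> B mB.
  have dE i j : P (X i @^-1` B j) = P (X 0%N @^-1` B j) by exact: sX.
  have [s' sK s'K] : bijective s by exact: injF_bij.
  transitivity (P [set w | forall j : 'I_n, B (s' j) (X j w)]).
    congr (P _); apply/seteqP; split => w /=.
      by move=> wB j; have := wB (s' j); rewrite tnth_mktuple s'K.
    by move=> wB i; have := wB (s i); rewrite tnth_mktuple sK.
  transitivity (P [set w | forall j : 'I_n, B j (X j w)]); last first.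
    by congr (P _); apply/seteqP; split => w /= wB i; have := wB i;
      rewrite /= tnth_mktuple.
  rewrite (iX (fun j => B (s' j)))// (iX B)//.
  transitivity (\prod_j P (X 0%N @^-1` B (s' j)))%E.
    by apply: eq_bigr => j _; exact: dE.
  transitivity (\prod_j P (X 0%N @^-1` B j))%E; last first.
    by apply: eq_bigr => j _; rewrite dE.
  by rewrite [RHS](reindex_inj (can_inj s'K)).
transitivity (\int[pushforward P W]_v F v)%E.
  by rewrite (ge0_integral_pushforward mW).
rewrite (eq_measure_integral (pushforward P V)).
  by rewrite (ge0_integral_pushforward mV).
by move=> A mA _; exact: VW.
Qed.

End independent_vectors.

(** * Random walks: Spitzer's identity and first passage *)

Section measurable_walk.
Context d (T : measurableType d) (R : realType).

Lemma measurable_psum (x : T -> nat -> R) n :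
  (forall i, measurable_fun setT (x ^~ i)) ->
  measurable_fun setT (fun w => psum (x w) n).
Proof.
move=> mx; elim: n => [|n IH].
  by under eq_fun do rewrite psum0; exact: measurable_cst.
by under eq_fun do rewrite psumS; exact: measurable_funD.
Qed.

Lemma measurable_walkmax (x : T -> nat -> R) n :
  (forall i, measurable_fun setT (x ^~ i)) ->
  measurable_fun setT (fun w => walkmax (x w) n).
Proof.
move=> mx; elim: n => [|n IH] /=; first exact: measurable_cst.
by apply: measurable_maxr => //; exact: measurable_psum.
Qed.

Lemma measurable_gt (f : T -> R) (u : R) : measurable_fun setT f ->
  measurable [set w | u < f w].
Proof.
move=> mf; have := mf measurableT _ (measurable_itv `]u, +oo[).
rewrite setTI; congr measurable.
by apply/seteqP; split => w /=; rewrite in_itv/= andbT.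
Qed.

Lemma measurable_ge (f : T -> R) (u : R) : measurable_fun setT f ->
  measurable [set w | u <= f w].
Proof.
move=> mf; have := mf measurableT _ (measurable_itv `[u, +oo[).
rewrite setTI; congr measurable.
by apply/seteqP; split => w /=; rewrite in_itv/= andbT.
Qed.

End measurable_walk.

Lemma measurable_nth_tuple {R : realType} n i :
  measurable_fun setT (fun v : n.-tuple R => nth 0 v i).
Proof.
have [ni|ni] := ltnP i n; last first.
  rewrite (_ : (fun v => _) = cst 0)//.
  by apply/funext => v; rewrite nth_default// size_tuple.
rewrite (_ : (fun v => _) = (fun v : n.-tuple R => tnth v (Ordinal ni))).
  exact: measurable_tnth.
by apply/funext => v; rewrite (tnth_nth 0).
Qed.

Lemma nth_mktuple_nat {R : realType} n (x : nat -> R) i : (i < n)%N ->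
  nth 0 [tuple x j | j < n] i = x i.
Proof. by move=> ni; rewrite -[i]/(val (Ordinal ni)) -tnth_nth tnth_mktuple. Qed.

Section random_walk.
Context d (T : measurableType d) (R : realType) (P : probability T R).
Variable X : nat -> {RV P >-> R}.
Local Open Scope ereal_scope.

Let x w i : R := X i w.

Let mx i : measurable_fun setT (x ^~ i).
Proof. exact: measurable_funPT. Qed.

Section spitzer.
Hypothesis iX : forall n, mutually_independent (fun i : 'I_n => X i).
Hypothesis sX : forall i, same_distribution (X i) (X 0%N).

Let cyclic_law n m c : (m <= n.+1)%N ->
  \int[P]_w (walkmax (fun i => x w ((c + i) %% n.+1)%N) m)%:E =
  \int[P]_w (walkmax (x w) m)%:E.
Proof.
move=> mn.
pose s (i : 'I_n.+1) : 'I_n.+1 := inord ((c + i) %% n.+1).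
have sE i : val (s i) = ((c + i) %% n.+1)%N by rewrite /s/= inordK// ltn_mod.
have s_inj : injective s.
  move=> i j /(congr1 val); rewrite !sE => /eqP; rewrite eqn_modDl.
  by rewrite !modn_small// => /eqP ij; exact: val_inj.
pose F (v : n.+1.-tuple R) := (walkmax (fun i => nth 0%R v i) m)%:E.
have mF : measurable_fun setT F.
  by apply/measurable_EFinP; apply: measurable_walkmax => i; exact: measurable_nth_tuple.
have F0 v : 0 <= F v by rewrite lee_fin walkmax_ge0.
have := iid_reindex (@iX n.+1) sX s_inj mF F0.
rewrite /F.
rewrite (eq_integral (fun w => (walkmax (fun i => x w ((c + i) %% n.+1)%N) m)%:E)); last first.
  move=> w _; congr EFin; apply: eq_walkmax => i im.
  have ni : (i < n.+1)%N by exact: leq_trans mn.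
  by rewrite -[i]/(val (Ordinal ni)) -tnth_nth tnth_mktuple sE.
move=> ->; apply: eq_integral => w _; congr EFin; apply: eq_walkmax => i im.
by rewrite (nth_mktuple_nat (x w))//; exact: leq_trans mn.
Qed.

(** All cyclic shifts of the increments have the same law, so the deterministic
    identity [sum_cyclic_walkmax] can be averaged over the shifts.  Every term is
    nonnegative, hence no integrability is at stake. *)
Lemma spitzer_step n :
  \int[P]_w (walkmax (x w) n.+1)%:E =
  n.+1%:R^-1%:E * \int[P]_w (Num.max (psum (x w) n.+1) 0)%:E +
  \int[P]_w (walkmax (x w) n)%:E.
Proof.
pose y w i := x w (i %% n.+1)%N.
have my i : measurable_fun setT (y ^~ i) by exact: mx.
have mys c m : measurable_fun setT (fun w => (walkmax (fun i => y w (c + i)%N) m)%:E).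
  by apply/measurable_EFinP; apply: measurable_walkmax.
have sum_int m : (m <= n.+1)%N ->
    \int[P]_w (\sum_(c < n.+1) walkmax (fun i => y w (c + i)%N) m)%R%:E =
    n.+1%:R%:E * \int[P]_w (walkmax (x w) m)%:E.
  move=> mn; under eq_integral do rewrite -sumEFin.
  rewrite ge0_integral_sum//; last by move=> c w _; rewrite lee_fin walkmax_ge0.
  under eq_bigr do rewrite cyclic_law//.
  by rewrite sumr_const card_ord mule_natl.
have := sum_int n.+1 (leqnn _).
under eq_integral => w _.
  rewrite sum_cyclic_walkmax; last by move=> i; rewrite /y modnDr.
  over.
under eq_integral do rewrite EFinD.
rewrite ge0_integralD//; last 4 first.
- by move=> w _; rewrite lee_fin le_max lexx orbT.
- by apply/measurable_EFinP; apply: measurable_maxr => //; exact: measurable_psum.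
- by move=> w _; rewrite lee_fin sumr_ge0// => c _; exact: walkmax_ge0.
- apply/measurable_EFinP; apply: measurable_sum => c.
  by apply/measurable_EFinP; exact: mys.
rewrite sum_int ?leqnSn//.
have -> : \int[P]_w (Num.max (psum (y w) n.+1) 0)%:E =
    \int[P]_w (Num.max (psum (x w) n.+1) 0)%:E.
  apply: eq_integral => w _; congr (EFin (Num.max _ _)).
  by apply: eq_psum => i ni; rewrite /y modn_small.
move=> /(congr1 (fun z => n.+1%:R^-1%:E * z)).
rewrite ge0_muleDr; last 2 first.
- by apply: integral_ge0 => w _; rewrite lee_fin le_max lexx orbT.
- by rewrite mule_ge0//; apply: integral_ge0 => w _; rewrite lee_fin walkmax_ge0.
by rewrite !muleA -!EFinM mulVf// !mul1e => <-.
Qed.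

Lemma spitzer n :
  \int[P]_w (walkmax (x w) n)%:E =
  \sum_(k < n) (k.+1%:R^-1%:E * \int[P]_w (Num.max (psum (x w) k.+1) 0)%:E).
Proof.
elim: n => [|n IH]; first by rewrite big_ord0; apply: integral0_eq.
by rewrite big_ord_recr/= spitzer_step IH addeC.
Qed.

End spitzer.

(** [Y k] stands for the part of the walk that remains after [k] steps; it is
    independent of the first [k] steps. *)
Section first_passage.
Variables (n : nat) (Y : nat -> {RV P >-> R}) (q u : R).
Hypotheses (q0 : (0 <= q)%R) (u0 : (0 <= u)%R).
Hypothesis YE : forall k w, Y k w = (psum (x w) n - psum (x w) k)%R.
Hypothesis iXY : forall k, (k <= n)%N ->
  mutually_independent (fun i : 'I_k.+1 => if (i < k)%N then X i else Y k).
Hypothesis Yq : forall k, (k <= n)%N -> q%:E <= P [set w | (0 <= Y k w)%R].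

(** Decompose according to the step at which the walk first exceeds [u]: if the
    remaining part is then nonnegative, the walk still exceeds [u] at the end. *)
Lemma first_passage_le :
  q%:E * P [set w | (u < walkmax (x w) n)%R] <= P [set w | (u < psum (x w) n)%R].
Proof.
pose S := [set w | (u < psum (x w) n)%R].
pose M m := [set w | (u < walkmax (x w) m)%R].
have mS : measurable S by apply: measurable_gt; exact: measurable_psum.
have mM m : measurable (M m) by apply: measurable_gt; exact: measurable_walkmax.
(* Strengthened for the induction over the horizon: the passage occurs by
   step [m], and the walk ends above [u]. *)
suff H m : (m <= n)%N -> q%:E * P (M m) <= P (M m `&` S).
  apply: (le_trans (H _ (leqnn n))); apply: le_measure; rewrite ?inE//.
  exact: measurableI.
elim: m => [_|m IH mn].
  rewrite (_ : M 0%N = set0) ?measure0 ?mule0//.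
  by apply/seteqP; split => w //=; rewrite /M/= ltNge u0.
(* first passage exactly at step [m.+1] *)
pose E := [set w | (walkmax (x w) m <= u < psum (x w) m.+1)%R].
have mE : measurable E.
  rewrite (_ : E = ~` M m `&` [set w | (u < psum (x w) m.+1)%R]).
    apply: measurableI; first exact: measurableC.
    by apply: measurable_gt; exact: measurable_psum.
  apply/seteqP; split => w /=; rewrite /E/M/=.
    by move=> /andP[a b]; split => //; apply/negP; rewrite -leNgt.
  by move=> [/negP a b]; rewrite b andbT leNgt.
have ME : M m.+1 = M m `|` E.
  apply/seteqP; split => w; rewrite /M /E/= lt_max.
    move=> /orP[h|h]; first by left.
    by have [h'|h'] := leP (walkmax (x w) m) u; [right; rewrite h|left].
  by move=> [h|/andP[_ h]]; apply/orP; [left|right].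
have dME : M m `&` E = set0.
  by apply/seteqP; split => w //=; rewrite /M/E/= => -[h /andP[]]; rewrite leNgt h.
rewrite ME setIUl !measureU//; last 3 first.
- exact: measurableI.
- exact: measurableI.
- by rewrite setIACA dME set0I.
rewrite ge0_muleDr// leeD//; first by apply: IH; exact: ltnW.
have Ep : P (E `&` [set w | (0 <= Y m.+1 w)%R]) =
    P E * P [set w | (0 <= Y m.+1 w)%R].
  pose X' i := if (i < m.+1)%N then X i else Y m.+1.
  pose A : set (m.+1.-tuple R) :=
    ~` [set v | (u < walkmax (fun i => nth 0%R v i) m)%R] `&`
    [set v | (u < psum (fun i => nth 0%R v i) m.+1)%R].
  have mA : measurable A.
    apply: measurableI; first apply: measurableC.
      apply: measurable_gt; apply: measurable_walkmax => i.
      exact: measurable_nth_tuple.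
    apply: measurable_gt; apply: measurable_psum => i.
    exact: measurable_nth_tuple.
  have := independent_vec_last (X := X') (@iXY _ mn) mA (measurable_itv `[0%R, +oo[).
  have X'm : X' m.+1 = Y m.+1 by rewrite /X' ltnn.
  have -> : X' m.+1 @^-1` `[0%R, +oo[ = [set w | (0 <= Y m.+1 w)%R].
    by rewrite X'm; apply/seteqP; split => w /=; rewrite in_itv/= andbT.
  rewrite (_ : _ @^-1` A = E)//.
  have nthE w i : (i < m.+1)%N -> nth 0%R (vec (fun i => X' i) m.+1 w) i = x w i.
    by move=> im; rewrite (nth_mktuple_nat (fun i => X' i w))// /X' im.
  have wE w : walkmax (fun i => nth 0%R (vec (fun i => X' i) m.+1 w) i) m = walkmax (x w) m.
    by apply: eq_walkmax => i im; rewrite nthE// ltnW.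
  have sE w : psum (fun i => nth 0%R (vec (fun i => X' i) m.+1 w) i) m.+1 = psum (x w) m.+1.
    by apply: eq_psum => i im; rewrite nthE.
  apply/seteqP; split => w; rewrite /A /E/= wE sE.
    by move=> [/negP]; rewrite -leNgt => ->.
  by move=> /andP[h ->]; split => //; apply/negP; rewrite -leNgt.
apply: (@le_trans _ _ (P (E `&` [set w | (0 <= Y m.+1 w)%R]))).
  by rewrite Ep muleC lee_wpmul2l// Yq.
apply: le_measure; rewrite ?inE.
- by apply: measurableI => //; apply: measurable_ge; exact: measurable_funPT.
- exact: measurableI.
- move=> w [wE /=]; rewrite YE subr_ge0 => h; split => //.
  by move: wE; rewrite /E/S/= => /andP[_ h']; exact: lt_le_trans h' h.
Qed.

End first_passage.

End random_walk.

(** * Marginal laws of the process *)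

Section stable_process_transform.
Context d (T : measurableType d) (R : realType) (P : probability T R).
Variables (alpha sigma : R) (Z : R -> {RV P >-> R}).
Hypotheses (halpha : 1 < alpha <= 2) (hsigma : 0 < sigma).
Hypothesis hZ : stable_levy_process alpha sigma Z.

Let alpha1 : 1 < alpha. Proof. by case/andP: halpha. Qed.
Let alpha0 : 0 < alpha. Proof. exact: lt_trans alpha1. Qed.

(** The tangent of the angle [pi - pi * alpha / 2], which lies in
    [[0, pi / 2[]: this angle determines the positivity parameter. *)
Definition skew : R := - tan (pi * alpha / 2).

Lemma atan_skew : atan skew = pi - pi * alpha / 2.
Proof.
have [a1 a2] := andP halpha.
have p0 := pi_gt0 R.
have -> : skew = tan (pi - pi * alpha / 2).
  rewrite /skew /tan sinB cosB sinpi cospi !mul0r addr0 sub0r.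
  by rewrite !mulN1r opprK invrN mulrN.
by rewrite tanK// in_itv/=; apply/andP; split; nra.
Qed.

Lemma char_funE (X : {RV P >-> R}) (theta : R) :
  char_fun X theta =
  complex.Complex (fine (\int[P]_w (cos (theta * X w))%:E))
          (fine (\int[P]_w (sin (theta * X w))%:E)).
Proof.
rewrite /char_fun ![in LHS]unlock; congr (complex.Complex (fine _) (fine _));
  apply: eq_integral => w _; apply: (congr1 EFin).
  set y := theta * X w.
  transitivity (expR (y * 0 - 0 * 1) * cos (y * 1 + 0 * 0) -
    0 * sin (y * 1 + 0 * 0)); first by [].
  by rewrite !(mul0r, mulr0, mulr1, subr0, addr0) expR0 mul1r.
set y := theta * X w.
transitivity (expR (y * 0 - 0 * 1) * sin (y * 1 + 0 * 0) +
  0 * cos (y * 1 + 0 * 0)); first by [].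
by rewrite !(mul0r, mulr0, mulr1, subr0, addr0) expR0 mul1r.
Qed.

(** The scale is [l = s `^ alpha^-1 * sigma] since
    [(l * x) `^ alpha = s * sigma `^ alpha * x `^ alpha]. *)
Lemma stable_process_transform (s : R) : 0 < s ->
  has_stable_transform P alpha skew (s `^ alpha^-1 * sigma) (Z s).
Proof.
move=> s0 x x0.
have [_ /(_ s x (ltW s0))] := hZ.
have fin (f : T -> R) : measurable_fun setT f -> (forall w, `|f w| <= 1) ->
    (\int[P]_w (f w)%:E)%E = (fine (\int[P]_w (f w)%:E)%E)%:E.
  move=> mf f1; rewrite fineK//; apply: integrable_fin_num => //.
  exact: bounded_integrable mf f1.
have mxZ : measurable_fun setT (fun w => x * Z s w).
  by apply: measurable_funM => //; exact: measurable_funPT.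
rewrite char_funE (fin _ (measurable_cos_comp mxZ)); last by move=> w; exact: cos_max.
rewrite (fin _ (measurable_sin_comp mxZ)); last by move=> w; exact: sin_max.
have lx : (s `^ alpha^-1 * sigma * x) `^ alpha = s * sigma `^ alpha * x `^ alpha.
  rewrite !powRM ?mulr_ge0 ?powR_ge0 ?(ltW hsigma)//.
  by rewrite -powRrM mulVf ?gt_eqF// powRr1// ltW.
rewrite /stable_re /stable_im lx (ger0_norm x0).
rewrite /skew; set A := s * sigma `^ alpha * x `^ alpha.
have Asg : A * (Num.sg x * tan (pi * alpha / 2)) = A * tan (pi * alpha / 2).
  rewrite /A; move: x0; rewrite le_eqVlt => /predU1P[<-|x0]; last by rewrite gtr0_sg// mul1r.
  by rewrite powR0 ?gt_eqF// mulr0 !mul0r.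
move: (tan (pi * alpha / 2)) Asg => b Asg.
move=> [-> ->]; rewrite /skew.
rewrite !(mul0r, mulr0, subr0, addr0, add0r, mul1r, mulr1) Asg (mulNr b) (mulrC b).
by [].
Qed.

End stable_process_transform.

(** * The walk of increments along a grid *)

Section grid_walk.
Context d (T : measurableType d) (R : realType) (P : probability T R).

Lemma ae_le_measure (A B : set T) : measurable A -> measurable B ->
  {ae P, forall w, A w -> B w} -> (P A <= P B)%E.
Proof.
move=> mA mB [N [mN PN sub]].
rewrite (@le_trans _ _ (P (B `|` N)))//.
  apply: le_measure; rewrite ?inE//; first exact: measurableU.
  move=> w Aw; have [Bw|nBw] := pselect (B w); first by left.
  by right; apply: sub => /= /(_ Aw).
by rewrite (le_trans (measureU2 _ mB mN))// [X in (_ + X)%E]PN adde0.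
Qed.

Lemma incrementE (Z : R -> {RV P >-> R}) s t w : increment Z s t w = Z t w - Z s w.
Proof. by []. Qed.

Variables (alpha sigma : R) (Z : R -> {RV P >-> R}).
Hypotheses (halpha : 1 < alpha <= 2) (hsigma : 0 < sigma).
Hypothesis hZ : stable_levy_process alpha sigma Z.

Let alpha1 : 1 < alpha. Proof. by case/andP: halpha. Qed.
Let alpha0 : 0 < alpha. Proof. exact: lt_trans alpha1. Qed.
Let p := alpha^-1.

(** The expectation of the positive part of [Z 1]. *)
Definition pos_part_const : R := abs_moment_const alpha (skew alpha) / 2 * sigma.

Lemma pos_part_Z s : 0 < s ->
  (\int[P]_w (Num.max (Z s w) 0)%:E = (pos_part_const * s `^ p)%:E)%E.
Proof.
move=> s0; have l0 : 0 < s `^ alpha^-1 * sigma by rewrite mulr_gt0// powR_gt0.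
rewrite (stable_pos_part_moment alpha1 l0 _ (stable_process_transform halpha hsigma hZ s0)).
  by congr EFin; rewrite /pos_part_const /p; ring.
exact: measurable_funPT.
Qed.

Lemma positivity_Z s : 0 < s -> P [set w | 0 < Z s w] = p%:E.
Proof.
move=> s0; have l0 : 0 < s `^ alpha^-1 * sigma by rewrite mulr_gt0// powR_gt0.
apply: (stable_positivity alpha1 l0 _ (stable_process_transform halpha hsigma hZ s0)).
  exact: measurable_funPT.
exact: atan_skew.
Qed.

Lemma no_atom0_Z s : 0 < s -> P [set w | Z s w = 0] = 0%E.
Proof.
move=> s0; have l0 : 0 < s `^ alpha^-1 * sigma by rewrite mulr_gt0// powR_gt0.
apply: (stable_no_atom0 alpha1 l0 _ (stable_process_transform halpha hsigma hZ s0)).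
exact: measurable_funPT.
Qed.

Let LZ : levy_process Z. Proof. by case: hZ. Qed.

Lemma pos_part_increment s : 0 < s ->
  (\int[P]_w (Num.max (Z s w - Z 0 w) 0)%:E = (pos_part_const * s `^ p)%:E)%E.
Proof.
move=> s0; rewrite -pos_part_Z//; apply: ge0_ae_eq_integral => //.
- apply/measurable_EFinP; apply: measurable_maxr => //.
  by apply: measurable_funB; exact: measurable_funPT.
- by apply/measurable_EFinP; apply: measurable_maxr => //; exact: measurable_funPT.
- by move=> w _; rewrite lee_fin le_max lexx orbT.
- by move=> w _; rewrite lee_fin le_max lexx orbT.
- by apply: filterS (levy_start0 LZ) => w /= -> _; rewrite subr0.
Qed.

Lemma measurable_increment_ge0 s t : measurable [set w | 0 <= increment Z s t w].
Proof. by apply: measurable_ge; exact: measurable_funPT. Qed.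

(** Increments over a positive time are nonnegative with probability at least
    [1 / alpha]; an empty one is nonnegative surely, and [1 / alpha < 1]. *)
Lemma increment_ge0_prob s t : 0 <= s -> s <= t ->
  (p%:E <= P [set w | (0 <= increment Z s t w)%R])%E.
Proof.
move=> s0; rewrite le_eqVlt => /predU1P[<-|st].
  rewrite (_ : [set w | _] = setT).
    by rewrite probability_setT lee_fin invf_le1// ltW.
  by apply/seteqP; split => w // _; rewrite /mkset incrementE subrr.
have ts : 0 < t - s by rewrite subr_gt0.
have := levy_stationary_increments LZ s0 (ltW ts) (measurable_itv `[0, +oo[).
rewrite subrKC => E.
have dE a b : distribution P (increment Z a b) `[0, +oo[ =
    P [set w | 0 <= increment Z a b w].
  by congr (P _); apply/seteqP; split => w /=; rewrite in_itv/= andbT.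
rewrite -dE E dE -(positivity_Z ts).
apply: ae_le_measure.
- by apply: measurable_gt; exact: measurable_funPT.
- exact: measurable_increment_ge0.
- by apply: filterS (levy_start0 LZ) => w w0 /ltW; rewrite /mkset incrementE w0 subr0.
Qed.

Variable h : R.
Hypothesis h0 : 0 < h.

Definition grid_increment i := increment Z (i%:R * h) (i.+1%:R * h).

Definition grid_walk w i : R := grid_increment i w.

Lemma psum_grid w k : psum (grid_walk w) k = Z (k%:R * h) w - Z 0 w.
Proof.
elim: k => [|k IH]; first by rewrite psum0 mul0r subrr.
by rewrite psumS IH /grid_walk /grid_increment incrementE; ring.
Qed.

Lemma grid_independent n : mutually_independent (fun i : 'I_n => grid_increment i).
Proof.
apply: (levy_independent_increments LZ (t := fun i => i%:R * h)).
  by rewrite mul0r.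
by move=> i _; rewrite ler_pM2r// ler_nat.
Qed.

Lemma grid_same_distribution i : same_distribution (grid_increment i) (grid_increment 0).
Proof.
rewrite /grid_increment mul0r mul1r.
have -> : i.+1%:R * h = i%:R * h + h by rewrite -natr1 mulrDl mul1r.
by apply: (levy_stationary_increments LZ); [rewrite mulr_ge0// ltW|exact: ltW].
Qed.

(** The remaining parts of the grid walk are again increments of the process, so
    their independence from the past follows from the one of increments along
    the times [0], [h], up to [k h], then [n h]. *)
Lemma grid_first_passage n u : 0 <= u ->
  (p%:E * P [set w | (u < walkmax (grid_walk w) n)%R] <=
   P [set w | (u < Z (n%:R * h) w - Z 0 w)%R])%E.
Proof.
move=> u0.
have := @first_passage_le _ _ _ P grid_increment n
  (fun k => increment Z (k%:R * h) (n%:R * h)) p u.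
rewrite (_ : [set w | u < psum _ n] = [set w | (u < Z (n%:R * h) w - Z 0 w)%R]); last first.
  by apply/seteqP; split => w /=; rewrite (psum_grid w n).
apply => //.
- by move=> k w; have E := psum_grid w; rewrite /grid_walk in E; rewrite !E incrementE; ring.
- move=> k kn.
  have := @levy_independent_increments _ _ _ _ _ LZ k.+1 (fun i => if (i <= k)%N then i%:R * h else n%:R * h).
  rewrite leq0n mul0r lexx => /(_ isT).
  have mono i : (i < k.+1)%N -> (if (i <= k)%N then i%:R * h else n%:R * h) <=
      (if (i.+1 <= k)%N then i.+1%:R * h else n%:R * h).
    rewrite ltnS => ik; rewrite ik; case: ifPn => _; rewrite ler_pM2r// ler_nat//.
    exact: leq_trans kn.
  move=> /(_ mono).
  congr mutually_independent; apply/funext => i.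
  rewrite -ltnS ltn_ord; case: ifPn => // ik.
  have -> : (i : nat) = k.
    by apply/eqP; rewrite eqn_leq -ltnS ltn_ord leqNgt.
  by [].
- by move=> k kn; apply: increment_ge0_prob; [rewrite mulr_ge0// ltW|rewrite ler_pM2r// ler_nat].
Qed.

Lemma expectation_grid_max n :
  (\int[P]_w (walkmax (grid_walk w) n)%:E =
   (pos_part_const * h `^ p * \sum_(k < n) (k.+1%:R `^ (p - 1)))%:E)%E.
Proof.
have := spitzer (X := grid_increment) grid_independent grid_same_distribution n.
rewrite -/(grid_walk _) => ->.
rewrite mulr_sumr -sumEFin; apply: eq_bigr => k _.
under eq_integral do rewrite (psum_grid _ k.+1).
rewrite pos_part_increment ?mulr_gt0// -EFinM; congr EFin.
rewrite powRM ?ltW//.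
have k0 : (k.+1%:R : R) != 0 by [].
rewrite powRB; last by rewrite k0 implybT.
by rewrite powRr1//; field.
Qed.

End grid_walk.

(** * Passage from the grid to continuous time *)

Section grid_approximation.
Context {R : realType}.

Lemma powRS_sub_le (p x : R) : 0 < p <= 1 -> 0 < x ->
  (x + 1) `^ p - x `^ p <= p * x `^ (p - 1).
Proof.
move=> /andP[p0 p1] x0.
have xx : x < x + 1 by rewrite ltrDl.
have pos (y : R) : x < y -> 0 < y by exact: lt_trans.
have [||c] := @MVT R (fun y => y `^ p) (fun y => p * y `^ (p - 1)) x (x + 1) xx.
- by move=> y; rewrite in_itv/= => /andP[/pos y0 _]; exact: is_derive1_powR.
- apply: derivable_within_continuous => y; rewrite in_itv/= => /andP[xy _].
  by apply: ex_derive; apply: is_derive1_powR; exact: lt_le_trans xy.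
rewrite in_itv/= => /andP[xc _] ->.
rewrite addrAC subrr add0r mulr1 ler_wpM2l ?(ltW p0)//.
rewrite -(opprK (p - 1)) opprB !powRN.
have c0 := pos _ xc.
rewrite lef_pV2 ?posrE ?powR_gt0//.
by apply: ge0_ler_powR; rewrite ?nnegrE ?subr_ge0// ltW.
Qed.

(** Each term dominates the increment of [x `^ p / p] on the following unit
    interval, by concavity. *)
Lemma sum_powR_ge (p : R) n : 0 < p <= 1 ->
  n.+1%:R `^ p - 1 <= p * \sum_(k < n) k.+1%:R `^ (p - 1).
Proof.
move=> p01; elim: n => [|n IH].
  by rewrite big_ord0 mulr0 powR1 subrr.
rewrite big_ord_recr/= mulrDr.
have := @powRS_sub_le p n.+1%:R p01 (ltr0Sn _ _).
rewrite natr1 => h; lra.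
Qed.

(** By right-continuity a value above [u] persists on a short interval to the
    right, which meets every fine enough grid; at the right end point [t] itself
    the grid is exact. *)
Lemma cadlag_grid_gt (f : R -> R) (t u : R) : cadlag f -> 0 < t ->
  (u%:E < ereal_sup [set (f s)%:E | s in `[0%R, t]])%E ->
  \forall n \near \oo, exists2 k, (k <= n.+1)%N & u < f (k%:R * (t / n.+1%:R)).
Proof.
move=> [rc _] t0 /ereal_sup_gt[_ /= [s + <-]]; rewrite lte_fin in_itv/=.
move=> /andP[s0]; rewrite le_eqVlt => /predU1P[->|st] us.
  apply: nearW => n; exists n.+1 => //.
  by rewrite mulrC divfK.
have : \forall x \near s^'+, u < f x by exact: (cvgr_gt _ (rc s s0)).
move=> [e /= e0 He].
have te : \forall n \near \oo, t / n.+1%:R < e.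
  have : (t * n.+1%:R^-1) @[n --> \oo] --> (0 : R).
    rewrite -[X in _ --> X](mulr0 t); apply: cvgM; first exact: cvg_cst.
    exact: cvg_invS0.
  by move=> /cvgr_lt; exact.
near=> n.
have n0 : (0 : R) < n.+1%:R by [].
have h0 : 0 < t / n.+1%:R by rewrite divr_gt0.
have he : t / n.+1%:R < e by near: n.
set h := t / n.+1%:R in h0 he *.
have sh0 : 0 <= s / h by rewrite divr_ge0// ltW.
have /andP[k1 k2] := truncn_itv sh0.
rewrite ler_pdivlMr// in k1; rewrite ltr_pdivrMr// in k2.
exists (Num.truncn (s / h)).+1.
  rewrite -(ltr_nat R) -(ltr_pM2r h0) (le_lt_trans k1)//.
  by rewrite /h mulrC divfK.
apply: He => //=.
rewrite ltr_distl; apply/andP; split; last by rewrite -ltrBlDr; lra.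
rewrite -natr1 mulrDl mul1r; lra.
Unshelve. all: by end_near. Qed.

End grid_approximation.

Section running_supremum.
Context d (T : measurableType d) (R : realType) (P : probability T R).
Variables (Z : R -> {RV P >-> R}) (t : R).
Hypotheses (cZ : forall w, cadlag (fun s => Z s w)) (t0 : 0 < t).
Local Open Scope ereal_scope.

Lemma le_running_sup s w : (0 <= s <= t)%R -> (Z s w)%:E <= running_sup Z t w.
Proof. by move=> st; apply: ereal_sup_ubound; exists s => //=; rewrite in_itv. Qed.

Lemma grid_point_in (n k : nat) : (k <= n.+1)%N -> (0 <= k%:R * (t / n.+1%:R) <= t)%R.
Proof.
move=> kn; have n0 : (0 < n.+1%:R :> R)%R by [].
rewrite mulr_ge0 ?divr_ge0 ?(ltW t0)//= mulrA ler_pdivrMr// mulrC ler_pM2l//.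
by rewrite ler_nat.
Qed.

Lemma measurable_running_sup_gt (u : R) :
  measurable [set w | u%:E < running_sup Z t w].
Proof.
rewrite (_ : [set w | _] = \bigcup_n \big[setU/set0]_(k < n.+2)
    [set w | (u < Z (k%:R * (t / n.+1%:R)) w)%R]).
  apply: bigcup_measurable => n _; apply: bigsetU_measurable => k _.
  by apply: measurable_gt; exact: measurable_funPT.
apply/seteqP; split => w /=.
  move=> /(cadlag_grid_gt (cZ w) t0) [N _ /(_ N (leqnn _))[k kN uk]].
  exists N => //; rewrite -bigcup_mkord_ord/=; exists k => //=.
  by rewrite inordK.
move=> [n _]; rewrite -bigcup_mkord_ord/= => -[k kn].
rewrite inordK// => uk; apply: lt_le_trans (le_running_sup w (grid_point_in _)).
  by rewrite lte_fin; exact: uk.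
by rewrite -ltnS.
Qed.

End running_supremum.

(** * Comparison of tails *)

Section tails.
Context {R : realType}.
Notation mu := (@lebesgue_measure R).

Lemma nonincreasing_tail_measurable (g : R -> R) (E : set R) : measurable E ->
  {homo g : x y / x <= y >-> y <= x} -> measurable_fun E g.
Proof.
move=> mE ng; rewrite (_ : g = \- (fun x => - g x)); last first.
  by apply/funext => x /=; rewrite opprK.
apply: measurable_funN; apply: nondecreasing_measurable => // x y xy.
by rewrite lerN2 ng.
Qed.

(** If [g u < h u] at some [u], right-continuity of [h] and monotonicity of both
    functions keep a positive gap on an interval starting at [u], so that the
    integrals would differ. *)
Lemma eq_tails (g h : R -> R) :
  (forall u, 0 <= g u) ->
  {homo g : x y / x <= y >-> y <= x} -> {homo h : x y / x <= y >-> y <= x} ->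
  (forall u, 0 <= u -> g u <= h u) ->
  (forall u c, c < h u -> exists2 e, 0 < e & c < h (u + e)) ->
  (\int[mu]_(u in `[0%R, +oo[) (h u)%:E <= \int[mu]_(u in `[0%R, +oo[) (g u)%:E)%E ->
  (\int[mu]_(u in `[0%R, +oo[) (h u)%:E < +oo)%E ->
  forall u, 0 <= u -> g u = h u.
Proof.
move=> g0 ng nh gh hr hg hoo u u0; apply/eqP; rewrite eq_le gh//= leNgt.
apply/negP => ghu.
pose m := (g u + h u) / 2.
have gm : g u < m by rewrite /m; lra.
have mh : m < h u by rewrite /m; lra.
have [e e0 me] := hr u m mh.
have mI : measurable (`[u, u + e]%classic : set R) by [].
have c0 : 0 < m - g u by rewrite subr_gt0.
have mg := nonincreasing_tail_measurable (measurable_itv `[0, +oo[) ng.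
have mh' := nonincreasing_tail_measurable (measurable_itv `[0, +oo[) nh.
have key : (\int[mu]_(v in `[0%R, +oo[) (g v)%:E + ((m - g u) * e)%:E <=
    \int[mu]_(v in `[0%R, +oo[) (h v)%:E)%E.
  have -> : ((m - g u) * e)%:E =
      (\int[mu]_(v in `[0%R, +oo[) ((m - g u) * \1_(`[u, (u + e)%R]) v)%:E)%E.
    under eq_integral do rewrite EFinM.
    rewrite ge0_integralZl//; last 2 first.
    - by apply/measurable_EFinP; exact: measurable_indic.
    - by rewrite lee_fin ltW.
    rewrite integral_indic// setIidl; last first.
      by move=> v /=; rewrite !in_itv/= andbT => /andP[uv _]; exact: le_trans uv.
    by rewrite /= lebesgue_measure_itv/= lte_fin ltrDl e0 -EFinB addrAC subrr add0r EFinM.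
  rewrite -ge0_integralD//; last 4 first.
  - by move=> v _; rewrite lee_fin.
  - exact/measurable_EFinP.
  - by move=> v _; rewrite lee_fin mulr_ge0// ltW.
  - by apply/measurable_EFinP; apply: measurable_funM => //; exact: measurable_indic.
  apply: ge0_le_integral => //.
  - by move=> v _; rewrite adde_ge0// lee_fin// mulr_ge0// ltW.
  - by apply: emeasurable_funD; apply/measurable_EFinP => //;
      apply: measurable_funM => //; exact: measurable_indic.
  - exact/measurable_EFinP.
  - move=> v /=; rewrite in_itv/= andbT => v0; rewrite -EFinD lee_fin indicE.
    have [|_] := boolP (v \in _); last by rewrite mulr0 addr0 gh.
    rewrite inE/= in_itv/= => /andP[uv ve]; rewrite mulr1.
    have := ng _ _ uv; have := nh _ _ ve; lra.
have := le_trans key hg.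
have gfin : (\int[mu]_(v in `[0%R, +oo[) (g v)%:E)%E \is a fin_num.
  rewrite ge0_fin_numE; last by apply: integral_ge0 => v _; rewrite lee_fin.
  apply: le_lt_trans hoo; apply: ge0_le_integral => //.
  - by move=> v _; rewrite lee_fin.
  - exact/measurable_EFinP.
  - exact/measurable_EFinP.
  - by move=> v /=; rewrite in_itv/= andbT => v0; rewrite lee_fin gh.
rewrite -(fineK gfin) -EFinD lee_fin gerDl leNgt mulr_gt0//.
Qed.

End tails.

Lemma layer_cake d (T : measurableType d) (R : realType) (P : probability T R)
    (f : T -> R) : measurable_fun setT f -> (forall w, 0 <= f w) ->
  (\int[P]_w (f w)%:E =
   \int[@lebesgue_measure R]_(u in `[0%R, +oo[) P [set w | (u < f w)%R])%E.
Proof.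
move=> mf f0.
pose X : {RV P >-> R} := HB.pack f (isMeasurableFun.Build _ _ _ _ f mf).
have := ge0_expectation_ccdf (X := X) f0; rewrite unlock => ->.
apply: eq_integral => u _; congr (P _).
by apply/seteqP; split => w /=; rewrite in_itv/= andbT.
Qed.

Lemma measurable_tail d (T : measurableType d) (R : realType)
    (P : probability T R) (f : T -> R) (E : set R) : measurable_fun setT f ->
  measurable_fun E (fun u => P [set w | (u < f w)%R]).
Proof.
move=> mf; apply: measurable_funTS.
pose X : {RV P >-> R} := HB.pack f (isMeasurableFun.Build _ _ _ _ f mf).
apply: eq_measurable_fun (ccdf_measurable X) => u _; congr (P _).
by apply/seteqP; split => w /=; rewrite in_itv/= andbT.
Qed.

(** * The law of the running supremum *)

Section supremum_law.
Context d (T : measurableType d) (R : realType) (P : probability T R).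
Variables (alpha sigma : R) (Z : R -> {RV P >-> R}).
Hypotheses (halpha : 1 < alpha <= 2) (hsigma : 0 < sigma).
Hypothesis hZ : stable_levy_process alpha sigma Z.
Variable t : R.
Hypothesis t0 : 0 < t.

Let alpha1 : 1 < alpha. Proof. by case/andP: halpha. Qed.
Let alpha0 : 0 < alpha. Proof. exact: lt_trans alpha1. Qed.
Let p := alpha^-1.
Let p01 : 0 < p <= 1. Proof. by rewrite invr_gt0 alpha0 invf_le1// ltW. Qed.
Let LZ : levy_process Z. Proof. by case: hZ. Qed.
Let cZ w : cadlag (fun s => Z s w). Proof. exact: (levy_cadlag LZ). Qed.

Let step (n : nat) : R := t / n.+1%:R.
Let step_gt0 n : 0 < step n. Proof. by rewrite divr_gt0. Qed.
Let stepE n : n.+1%:R * step n = t. Proof. by rewrite /step mulrC divfK. Qed.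

Let grid_max n w := walkmax (grid_walk Z (step n) w) n.+1.

Let measurable_grid_max n : measurable_fun setT (grid_max n).
Proof. by apply: measurable_walkmax => i; exact: measurable_funPT. Qed.

Local Open Scope ereal_scope.

Let grid_max_tail_le n u : (0 <= u)%R ->
  P [set w | (u < grid_max n w)%R] <= alpha%:E * P [set w | (u < Z t w)%R].
Proof.
move=> u0.
have := grid_first_passage halpha hsigma hZ (step_gt0 n) n.+1 u0.
rewrite stepE => le1.
have le2 : P [set w | (u < Z t w - Z 0 w)%R] <= P [set w | (u < Z t w)%R].
  apply: ae_le_measure.
  - by apply: measurable_gt; apply: measurable_funB; exact: measurable_funPT.
  - by apply: measurable_gt; exact: measurable_funPT.
  - by apply: filterS (levy_start0 LZ) => w w0; rewrite /mkset w0 subr0.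
have := le_trans le1 le2.
by rewrite -/p lee_pdivrMl.
Qed.

Let grid_max_le_sup n u : (0 <= u)%R ->
  P [set w | (u < grid_max n w)%R] <= P [set w | u%:E < running_sup Z t w].
Proof.
move=> u0; apply: ae_le_measure.
- exact: measurable_gt.
- exact: measurable_running_sup_gt.
- apply: filterS (levy_start0 LZ) => w w0; rewrite /mkset /grid_max.
  have [k kn ->] := walkmax_attained (grid_walk Z (step n) w) n.+1.
  rewrite (psum_grid Z (step n) w k) w0 subr0 => uk.
  apply: lt_le_trans (le_running_sup Z w (grid_point_in t0 kn)).
  by rewrite lte_fin.
Qed.

(** If the supremum exceeds [u], so do all grid maxima of fine enough mesh; the
    grids need not be nested, whence the increasing intersections [B m]. *)
Lemma sup_tail_le u : (0 <= u)%R ->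
  P [set w | u%:E < running_sup Z t w] <= alpha%:E * P [set w | (u < Z t w)%R].
Proof.
move=> u0.
pose A n := [set w | (u < grid_max n w)%R].
have mA n : measurable (A n) by exact: measurable_gt.
pose B m := \bigcap_(n in [set n | (m <= n)%N]) A n.
have mB m : measurable (B m) by apply: bigcap_measurableType.
have mUB : measurable (\bigcup_m B m) by exact: bigcupT_measurable.
apply: (@le_trans _ _ (P (\bigcup_m B m))).
  apply: ae_le_measure => //; first exact: measurable_running_sup_gt.
  apply: filterS (levy_start0 LZ) => w w0 /(cadlag_grid_gt (cZ w) t0)[N _ HN].
  exists N => // n Nn; have [k kn uk] := HN n Nn.
  apply: lt_le_trans (psum_le_walkmax _ kn).
  by rewrite (psum_grid Z (step n) w k) w0 subr0.
have ndB : nondecreasing_seq B.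
  move=> m n mn; apply/subsetPset => w Bw k nk; apply: Bw.
  exact: leq_trans nk.
have cvB : P (B m) @[m --> \oo] --> P (\bigcup_m B m).
  exact: nondecreasing_cvg_mu.
rewrite -(cvg_lim _ cvB)//; apply: lime_le; first by apply/cvg_ex; eexists; exact: cvB.
apply: nearW => m; apply: le_trans (grid_max_tail_le m u0).
apply: le_measure; rewrite ?inE; [exact: mB|exact: mA|].
by move=> w Bw; apply: Bw => /=.
Qed.

Let C := pos_part_const alpha sigma.

Lemma pos_part_const_ge0 : (0 <= pos_part_const alpha sigma)%R.
Proof.
have := pos_part_Z halpha hsigma hZ ltr01; rewrite powR1 mulr1 => E.
rewrite -lee_fin -E; apply: integral_ge0 => w _.
by rewrite lee_fin le_max lexx orbT.
Qed.

(** The expectation is a Riemann sum of the decreasing function [s `^ (p - 1)]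
    over [[0, t]], bounded from below by the integral over all cells but the
    first one. *)
Lemma expectation_grid_max_ge n :
  (C * alpha * t `^ p * (1 - n.+1%:R^-1 `^ p))%:E <= \int[P]_w (grid_max n w)%:E.
Proof.
rewrite (expectation_grid_max halpha hsigma hZ (step_gt0 n)) lee_fin -/C -/p.
have n0 : (0 < n.+1%:R :> R)%R by [].
rewrite /step powRM ?(ltW t0)//.
have C0 : (0 <= C)%R by exact: pos_part_const_ge0.
move: (C) C0 => D D0.
rewrite -!mulrA; apply: ler_wpM2l => //; rewrite mulrCA.
apply: ler_wpM2l; first exact: powR_ge0.
have := sum_powR_ge n.+1 p01.
set S := (\sum_(_ < _) _)%R => hS.
have hS' : (alpha * (n.+2%:R `^ p - 1) <= S)%R.
  by rewrite -ler_pdivlMl// -/p.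
have pw : ((1 <= n.+1%:R^-1 `^ p * n.+2%:R `^ p :> R))%R.
  rewrite -powRM// mulrC; apply: (@le_trans _ _ (1 `^ p)%R).
    by rewrite powR1.
  have p0 : (0 <= p)%R by case/andP: p01 => /ltW.
  by rewrite ge0_ler_powR ?nnegrE ?divr_ge0// ler_pdivlMr// mul1r ler_nat.
apply: (@le_trans _ _ (n.+1%:R^-1 `^ p * (alpha * (n.+2%:R `^ p - 1)))%R); last first.
  by rewrite ler_wpM2l ?powR_ge0.
rewrite mulrCA ler_pM2l// mulrBr mulr1 lerD2r.
exact: pw.
Qed.

Lemma integral_tail_Z :
  \int[@lebesgue_measure R]_(u in `[0%R, +oo[) (alpha%:E * P [set w | (u < Z t w)%R]) =
  (C * alpha * t `^ p)%:E.
Proof.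
have m0 : measurable_fun setT (fun w => Num.max (Z t w) 0%R).
  by apply: measurable_maxr => //; exact: measurable_funPT.
have m1 w : (0 <= Num.max (Z t w) 0)%R by rewrite le_max lexx orbT.
have E := layer_cake P m0 m1.
rewrite (pos_part_Z halpha hsigma hZ t0) -/p in E.
rewrite [in RHS]mulrAC [in RHS]mulrC EFinM /C E.
rewrite ge0_integralZl_EFin//.
- congr (_ * _); apply: eq_integral => u; rewrite inE/= in_itv/= andbT => u0.
  by congr (P _); apply/seteqP; split => w /=; rewrite lt_max [(u < 0)%R]ltNge u0 orbF.
- by apply: measurable_tail; exact: measurable_funPT.
- exact: ltW.
Qed.

(** The grid maxima give the lower bound on the integral of the tail of the
    supremum. *)
Lemma sup_tailE u : (0 <= u)%R ->
  P [set w | u%:E < running_sup Z t w] = alpha%:E * P [set w | (u < Z t w)%R].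
Proof.
move=> u0.
have mG v : measurable [set w | v%:E < running_sup Z t w].
  exact: measurable_running_sup_gt.
have mH v : measurable [set w | (v < Z t w)%R].
  by apply: measurable_gt; exact: measurable_funPT.
pose g v := fine (P [set w | v%:E < running_sup Z t w]).
pose h v := (alpha * fine (P [set w | (v < Z t w)%R]))%R.
have gE v : P [set w | v%:E < running_sup Z t w] = (g v)%:E.
  by rewrite fineK// fin_num_measure.
have hE v : alpha%:E * P [set w | (v < Z t w)%R] = (h v)%:E.
  by rewrite EFinM fineK// fin_num_measure.
rewrite gE hE; congr EFin.
have intH : \int[@lebesgue_measure R]_(u in `[0%R, +oo[) (h u)%:E = (C * alpha * t `^ p)%:E.
  by rewrite -integral_tail_Z; apply: eq_integral => v _; rewrite hE.
have ng : {homo g : x y / (x <= y)%R >-> (y <= x)%R}.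
  move=> x y xy; rewrite -lee_fin -!gE; apply: le_measure; rewrite ?inE//.
  by move=> w /=; apply: le_lt_trans; rewrite lee_fin.
have nh : {homo h : x y / (x <= y)%R >-> (y <= x)%R}.
  move=> x y xy; rewrite -lee_fin -!hE lee_wpmul2l ?lee_fin ?(ltW alpha0)//.
  apply: le_measure; rewrite ?inE//.
  by move=> w /=; exact: le_lt_trans.
apply: (@eq_tails _ g h) => //.
- by move=> v; rewrite fine_ge0.
- by move=> v v0; rewrite -lee_fin -gE -hE sup_tail_le.
- move=> v c cv.
  pose E n := [set w | (v + n.+1%:R^-1 < Z t w)%R].
  have mE n : measurable (E n) by exact: mH.
  have UE : \bigcup_n E n = [set w | (v < Z t w)%R].
    apply/seteqP; split => w /=.
      by move=> [n _]; apply: le_lt_trans; rewrite lerDl.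
    by move=> /ltr_add_invr[n vn]; exists n.
  have ndE : nondecreasing_seq E.
    move=> m n mn; apply/subsetPset => w; rewrite /E/=; apply: le_lt_trans.
    by rewrite lerD2l lef_pV2 ?posrE// ler_nat.
  have cvE : P (E n) @[n --> \oo] --> P (\bigcup_n E n).
    by apply: nondecreasing_cvg_mu => //; rewrite UE.
  have cvh : alpha%:E * P (E n) @[n --> \oo] --> (h v)%:E.
    by rewrite -hE -UE; apply: cvgeZl.
  have /fine_cvgP[_ cvf] := cvh.
  have [n _ Hn] := cvgr_gt _ cvf _ cv.
  exists n.+1%:R^-1%R => //.
  by have := Hn n (leqnn n); rewrite /= /E hE.
- rewrite intH.
  have lb n : (C * alpha * t `^ p * (1 - n.+1%:R^-1 `^ p))%:E <=
      \int[@lebesgue_measure R]_(u in `[0%R, +oo[) (g u)%:E.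
    apply: (le_trans (expectation_grid_max_ge n)).
    rewrite layer_cake//; last by move=> w; exact: walkmax_ge0.
    apply: ge0_le_integral => //.
    + exact: measurable_tail.
    + by apply/measurable_EFinP; exact: nonincreasing_tail_measurable.
    + move=> v /=; rewrite in_itv/= andbT => v0.
      by rewrite -gE grid_max_le_sup.
  have cvl : (C * alpha * t `^ p * (1 - n.+1%:R^-1 `^ p))%:E @[n --> \oo] -->
      (C * alpha * t `^ p)%:E.
    apply/cvg_EFin; first exact: nearW.
    rewrite -[X in _ --> X]mulr1; apply: cvgM; first exact: cvg_cst.
    rewrite -[X in _ --> X]subr0; apply: cvgB; first exact: cvg_cst.
    by apply: cvg_natS_powRN; case/andP: p01.
  rewrite -(cvg_lim _ cvl)//; apply: lime_le; first by apply/cvg_ex; eexists; exact: cvl.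
  exact: nearW.
- by rewrite intH ltry.
Qed.

End supremum_law.

(** Closed upper events as limits of open ones.  The shift [e / n] is left free:
    with [e = u] all the shifted thresholds stay nonnegative. *)
Section tails_from_below.
Context d (T : measurableType d) (R : realType) (P : probability T R).
Variables (f : T -> \bar R) (u e : R).
Hypothesis e0 : 0 < e.
Hypothesis mf : forall v, measurable [set w | (v%:E < f w)%E].

Let E n := [set w | ((u - e / n.+1%:R)%:E < f w)%E].

Let setgeE : [set w | (u%:E <= f w)%E] = \bigcap_n E n.
Proof.
apply/seteqP; split => w /=.
  move=> uf n _; apply: lt_le_trans uf.
  by rewrite lte_fin ltrBlDr ltrDl divr_gt0.
move=> H; rewrite leNgt; apply/negP => fu.
have := H 0%N I; rewrite /E/=.
case fw: (f w) fu => [r| |]//; rewrite lte_fin => ru _.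
have uer : 0 < (u - r) / e by rewrite divr_gt0// subr_gt0.
have [n] := ltr_add_invr uer.
rewrite add0r ltr_pdivlMr// mulrC => h.
have := H n I; rewrite /E /mkset fw lte_fin => h2.
by clear fw; move: (e / n.+1%:R) h h2 => x h h2; lra.
Qed.

Lemma measurable_ge_from_gt : measurable [set w | (u%:E <= f w)%E].
Proof. by rewrite setgeE; apply: bigcapT_measurable => n; exact: mf. Qed.

Lemma cvg_tail_below :
  P [set w | ((u - e / n.+1%:R)%:E < f w)%E] @[n --> \oo] -->
  P [set w | (u%:E <= f w)%E].
Proof.
rewrite setgeE; apply: nonincreasing_cvg_mu => //.
- exact: (le_lt_trans (probability_le1 P (mf _)) (ltry 1)).
- by apply: bigcapT_measurable => n; exact: mf.
- move=> m n mn; apply/subsetPset => w; rewrite /E/=; apply: le_lt_trans.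
  by rewrite lee_fin lerD2l lerN2 ler_pM2l// lef_pV2 ?posrE// ler_nat.
Qed.

End tails_from_below.

Theorem theorem1 (R : realType) (d : measure_display) (T : measurableType d)
    (P : probability T R) (alpha sigma : R)
    (halpha : 1 < alpha <= 2) (hsigma : 0 < sigma)
    (Z : R -> {RV P >-> R}) (hZ : stable_levy_process alpha sigma Z)
    (t u : R) (ht : 0 < t) (hu : 0 <= u) :
  P [set w | (u%:E <= running_sup Z t w)%E] =
    (alpha%:E * P [set w | (u <= Z t w)%R])%E.
Proof.
have LZ : levy_process Z by case: hZ.
have mG v : measurable [set w | (v%:E < running_sup Z t w)%E].
  by apply: measurable_running_sup_gt => //; exact: levy_cadlag LZ.
have mH v : measurable [set w | v < Z t w].
  by apply: measurable_gt; exact: measurable_funPT.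
have alpha0 : 0 < alpha by case/andP: halpha => /(lt_trans ltr01).
move: hu; rewrite le_eqVlt => /predU1P[<-|u0].
  (* For [u = 0] both sides are [1]: the supremum dominates [Z 0 = 0], and
     [Z t] has no atom at [0]. *)
  have mS : measurable [set w | (0%:E <= running_sup Z t w)%E].
    exact: (measurable_ge_from_gt _ ltr01).
  have -> : P [set w | (0%:E <= running_sup Z t w)%E] = 1%E.
    apply/eqP; rewrite eq_le probability_le1//= -(probability_setT P).
    apply: ae_le_measure => //; apply: filterS (levy_start0 LZ) => w w0 _.
    rewrite /mkset -w0; apply: le_running_sup; rewrite lexx/=; exact: ltW.
  have -> : [set w | 0 <= Z t w] = [set w | 0 < Z t w] `|` [set w | Z t w = 0].
    apply/seteqP; split => w /=; rewrite le_eqVlt.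
      by move=> /predU1P[<-|]; [right|left].
    by move=> [->|->]; rewrite ?orbT ?eqxx.
  rewrite measureU//; last 2 first.
  - have := measurable_funPT (Z t) measurableT _ (measurable_set1 0).
    by rewrite setTI.
  - by apply/seteqP; split => w // [h e]; move: (h : 0 < Z t w); rewrite (e : Z t w = 0) ltxx.
  rewrite [X in (_ + X)%E](no_atom0_Z halpha hsigma hZ ht) adde0.
  by rewrite [X in (_ * X)%E](positivity_Z halpha hsigma hZ ht) -EFinM mulfV ?gt_eqF.
have cvS := @cvg_tail_below _ _ _ P _ u u u0 mG.
have cvZ := @cvg_tail_below _ _ _ P (EFin \o Z t) u u u0 mH.
rewrite -(cvg_lim _ cvS)//; apply/cvg_lim => //.
have vn n : 0 <= u - u / n.+1%:R.
  by rewrite subr_ge0 ler_pdivrMr// ler_peMr ?(ltW u0)// ler1n.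
under eq_fun do rewrite (sup_tailE halpha hsigma hZ ht (vn _)).
exact: cvgeZl.
Qed.
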